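(* Let $\mathcal{B}_i$, $i=1,\ldots,k$, be pairwise disjoint closed sub-arrangements of a set-arrangement $\mathcal{A}$ on $X$ such that $\bigcup_{i=1}^k\mathcal{B}_i=\mathcal{A}$, and let $\mathcal{L}$ be a Lie algebra of $\mathcal{A}$. Suppose that $\mathcal{L}$ satisfies the replacement condition and that all two-element sets in $\mathcal{A}$ are (pairwise) disjoint. Suppose also that either (i) $\mathcal{L}$ is graded by giving the generators in $X$ some positive integer degrees, or (ii) for all $i=1,\ldots,k$ there is at most one $B\in\mathcal{A}$ such that $|B|=2$ and $\operatorname{supp}(\mathcal{B}_i)\cap B\neq\emptyset$. Then the following conditions are equivalent: 1) $[x,\operatorname{im}(s_{\mathcal{B}_i}')]=0$ for all $i=1,\ldots,k$ and all $x\in X\setminus\operatorname{supp}(\mathcal{B}_i)$; 2) $\operatorname{im}(s_{\mathcal{B}_i}')$ is an ideal in $\mathcal{L}$ for all $i=1,\ldots,k$; 3) $\mathcal{L}'=\sum_{i=1}^k\operatorname{im}(s_{\mathcal{B}_i}')$; 4) $s'$ is surjective; 5) $\pi'$ is injective; 6) $[x,[y,z]]=0$ in $\mathcal{L}$ for all $i=1,\ldots,k$, all $y,z\in\operatorname{supp}(\mathcal{B}_i)$ and all $x\in X\setminus\operatorname{supp}(\mathcal{B}_i)$.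
   Context: Let $C$ be a commutative ring with unit. All Lie algebras are ordinary (non-super) Lie algebras over $C$; $\mathcal{F}(Y)$ denotes the free Lie algebra over $C$ on a set $Y$, and $\mathfrak{g}'=[\mathfrak{g},\mathfrak{g}]$ the derived Lie algebra. A set-arrangement on a finite set $X=\{x_1,\ldots,x_n\}$, $n\ge 2$, is a set $\mathcal{A}$ of subsets of $X$ such that each set in $\mathcal{A}$ has at least two elements, two different sets in $\mathcal{A}$ have at most one element in common, and the union of all the sets in $\mathcal{A}$ is $X$. A Lie algebra $\mathcal{L}$ of the set-arrangement $\mathcal{A}$ is a quotient of $\mathcal{F}(X)$ by the ideal generated by all $[x_i,x_j]$ such that $\{x_i,x_j\}$ is not a subset of any $A\in\mathcal{A}$, together with $R=\bigcup_{A\in\mathcal{A}}R_A$, where for each $A\in\mathcal{A}$, $R_A$ is a given subset of $\mathcal{F}(A)'$. The localized Lie algebra at $A\in\mathcal{A}$ is $\mathcal{L}_A=\mathcal{F}(A)/\langle R_A\rangle$. $\mathcal{L}$ satisfies the replacement condition if for all $A\in\mathcal{A}$ with $|A|\ge 3$ and all $x\in A$ such that $x\in B$ for some $B\in\mathcal{A}$ with $B\neq A$, the derived algebra $\mathcal{L}_A'$ is contained in the Lie subalgebra of $\mathcal{L}_A$ generated by $A\setminus\{x\}$. Condition (i) means that for some assignment of positive integer degrees to the elements of $X$, the induced grading of $\mathcal{F}(X)$ descends to a grading of $\mathcal{L}$ (i.e. the defining ideal of $\mathcal{L}$ is homogeneous). For $\mathcal{B}\subseteq\mathcal{A}$, $\operatorname{supp}(\mathcal{B})=\bigcup_{B\in\mathcal{B}}B$;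 $\mathcal{B}$ is a closed sub-arrangement of $\mathcal{A}$ if $|A\cap\operatorname{supp}(\mathcal{B})|\le 1$ for all $A\in\mathcal{A}\setminus\mathcal{B}$. For a closed sub-arrangement $\mathcal{B}$, the localized Lie algebra at $\mathcal{B}$ is $\mathcal{L}_{\mathcal{B}}=\mathcal{F}(\operatorname{supp}(\mathcal{B}))/\langle R_{\mathcal{B}}\rangle$, where $$R_{\mathcal{B}}=\bigcup_{B\in\mathcal{B}}R_B\cup\{[x,y]:\ x,y\in\operatorname{supp}(\mathcal{B})\text{ and } \{x,y\}\not\subseteq B \text{ for all } B\in\mathcal{B}\}.$$ $s_{\mathcal{B}}:\mathcal{L}_{\mathcal{B}}\to\mathcal{L}$ is the natural (well-defined) Lie algebra morphism sending each generator to itself, and $\pi_{\mathcal{B}}:\mathcal{L}\to\mathcal{L}_{\mathcal{B}}$ is the (well-defined) Lie algebra morphism sending all generators not in $\operatorname{supp}(\mathcal{B})$ to zero and each generator in $\operatorname{supp}(\mathcal{B})$ to itself. $s_{\mathcal{B}}':\mathcal{L}_{\mathcal{B}}'\to\mathcal{L}'$ and $\pi_{\mathcal{B}}':\mathcal{L}'\to\mathcal{L}_{\mathcal{B}}'$ are their restrictions to derived algebras. Given $\mathcal{B}_1,\ldots,\mathcal{B}_k$ as in the claim (a partition of $\mathcal{A}$, not of $\operatorname{supp}(\mathcal{A})$), the $C$-module morphisms $s'$ and $\pi'$ are $$s'=\sum_{i=1}^k s_{\mathcal{B}_i}':\ \bigoplus_{i=1}^k\mathcal{L}_{\mathcal{B}_i}'\to\mathcal{L}',\qquad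 \pi'=\bigoplus_{i=1}^k\pi_{\mathcal{B}_i}':\ \mathcal{L}'\to\bigoplus_{i=1}^k\mathcal{L}_{\mathcal{B}_i}'.$$ *)

(* Defs.v *)
From HB Require Import structures.
From mathcomp Require Import all_boot all_order all_algebra.
From mathcomp Require Import boolp classical_sets.

Set Implicit Arguments.
Unset Strict Implicit.
Unset Printing Implicit Defensive.

Import GRing.Theory.
Local Open Scope ring_scope.
Local Open Scope quotient_scope.

Reserved Notation "[ 'lie' x , y ]" (at level 0, format "[ 'lie'  x ,  y ]").
Reserved Notation "{ 'lie' L -> M }" (at level 0, L at level 98, M at level 99).


HB.mixin Record isLie (C : comPzRingType) L of GRing.Lmodule C L := {
  lie_br : L -> L -> L;
  lie_linl : forall a x y z,
    lie_br (a *: x + y) z = a *: lie_br x z + lie_br y z;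
  lie_linr : forall a x y z,
    lie_br x (a *: y + z) = a *: lie_br x y + lie_br x z;
  lie_alt : forall x, lie_br x x = 0;
  lie_jacobi : forall x y z,
    lie_br x (lie_br y z) + lie_br y (lie_br z x) + lie_br z (lie_br x y) = 0
}.

#[short(type="lieAlgType")]
HB.structure Definition LieAlgebra (C : comPzRingType) :=
  { L of isLie C L & GRing.Lmodule C L }.

Notation "[ 'lie' x , y ]" := (lie_br x y) : ring_scope.

HB.mixin Record isLieMorphism (C : comPzRingType) (L M : lieAlgType C)
    (f : L -> M) := {
  lie_morph : forall x y, f [lie x, y] = [lie f x, f y]
}.

#[short(type="lieHom")]
HB.structure Definition LieMorphism (C : comPzRingType) (L M : lieAlgType C) :=
  { f of isLieMorphism C L M f & @GRing.Linear C L M *:%R f }.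

Notation "{ 'lie' L -> M }" := (lieHom L%type M%type) : type_scope.

Section LieTheory.
Variables (C : comPzRingType) (L : lieAlgType C).
Implicit Types (S : set L) (x y z : L).

Definition is_submodule S : Prop :=
  S 0 /\ forall (a : C) x y, S x -> S y -> S (a *: x + y).

Definition is_lie_subalgebra S : Prop :=
  is_submodule S /\ forall x y, S x -> S y -> S [lie x, y].

Definition is_lie_ideal S : Prop :=
  is_submodule S /\ forall x y, S y -> S [lie x, y].

Definition span_gen S : set L := smallest is_submodule S.
Definition subalgebra_gen S : set L := smallest is_lie_subalgebra S.
Definition ideal_gen S : set L := smallest is_lie_ideal S.

Definition derived : set L :=
  span_gen (fun u => exists x y, u = [lie x, y]).

Lemma lie0l x : [lie 0, x] = 0.
Proof.
by have := lie_linl 1 0 0 x; rewrite !scale1r addr0 -[LHS]addr0 => /addrI.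
Qed.

Lemma lie0r x : [lie x, 0] = 0.
Proof.
by have := lie_linr 1 x 0 0; rewrite !scale1r addr0 -[LHS]addr0 => /addrI.
Qed.

Lemma lieDl x y z : [lie x + y, z] = [lie x, z] + [lie y, z].
Proof. by rewrite -[x in LHS]scale1r lie_linl scale1r. Qed.

Lemma lieDr x y z : [lie x, y + z] = [lie x, y] + [lie x, z].
Proof. by rewrite -[y in LHS]scale1r lie_linr scale1r. Qed.

Lemma lieZl a x y : [lie a *: x, y] = a *: [lie x, y].
Proof. by rewrite -[X in [lie X, _]]addr0 lie_linl lie0l addr0. Qed.

Lemma lieZr a x y : [lie x, a *: y] = a *: [lie x, y].
Proof. by rewrite -[X in [lie _, X]]addr0 lie_linr lie0r addr0. Qed.

Lemma lieC x y : [lie x, y] = - [lie y, x].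
Proof.
have := lie_alt (x + y); rewrite lieDl !lieDr !lie_alt add0r addr0.
by move/eqP; rewrite addr_eq0 => /eqP.
Qed.

Lemma submodule0 S : is_submodule S -> S 0. Proof. by case. Qed.

Lemma submoduleD S x y : is_submodule S -> S x -> S y -> S (x + y).
Proof. by case=> _ lS Sx Sy; rewrite -[x]scale1r; apply: lS. Qed.

Lemma submoduleZ S a x : is_submodule S -> S x -> S (a *: x).
Proof. by case=> S0 lS Sx; rewrite -[_ *: x]addr0; apply: lS. Qed.

Lemma submoduleN S x : is_submodule S -> S x -> S (- x).
Proof. by move=> sS Sx; rewrite -scaleN1r; apply: submoduleZ. Qed.

Lemma smallest_submodule (P : set L -> Prop) S :
  (forall T, P T -> is_submodule T) -> is_submodule (smallest P S).
Proof.
move=> PS; split=> [T [PT _]|a x y Sx Sy T ST]; first exact: submodule0 (PS _ PT).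
by have [_] := PS _ (proj1 ST); apply; [apply: Sx | apply: Sy].
Qed.

Lemma span_genP S : is_submodule (span_gen S).
Proof. exact: smallest_submodule. Qed.

Lemma derived_submodule : is_submodule derived.
Proof. exact: span_genP. Qed.

Lemma subalgebra_genP S : is_lie_subalgebra (subalgebra_gen S).
Proof.
split=> [|x y Sx Sy T ST]; first by apply: smallest_submodule => T [].
by have [_] := proj1 ST; apply; [apply: Sx | apply: Sy].
Qed.

Lemma ideal_genP S : is_lie_ideal (ideal_gen S).
Proof.
split=> [|x y Sy T ST]; first by apply: smallest_submodule => T [].
by have [_] := proj1 ST; apply; apply: Sy.
Qed.

Lemma derived_lie x y : derived [lie x, y].
Proof. by apply: sub_gen_smallest; exists x, y. Qed.

End LieTheory.
Arguments derived {C} L _.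

Section DerivedAlgebra.
Variables (C : comPzRingType) (L : lieAlgType C).

Record derived_alg := DerivedAlg {
  derived_val :> L;
  _ : derived_val \in derived L
}.

HB.instance Definition _ := [isSub for derived_val].
HB.instance Definition _ := [Choice of derived_alg by <:].

Fact derived_subsemimod_closed :
  GRing.subsemimod_closed (fun x => x \in derived L).
Proof.
have dS := derived_submodule L; split; first split.
- by rewrite inE; apply: submodule0.
- by move=> x y; rewrite !inE; apply: submoduleD.
- by move=> a x; rewrite !inE; apply: submoduleZ.
Qed.

HB.instance Definition _ := GRing.SubChoice_isSubLmodule.Build C L
  (fun x => x \in derived L) derived_alg derived_subsemimod_closed.

Lemma derived_valP (u : derived_alg) : derived L u.
Proof. by apply/set_mem; case: u. Qed.

End DerivedAlgebra.

Section DerivedMap.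
Variables (C : comPzRingType) (L M : lieAlgType C) (f : {lie L -> M}).

Lemma derived_morph x : derived L x -> derived M (f x).
Proof.
have [D0 DD] := derived_submodule M.
move=> /(_ (fun y => derived M (f y))); apply; split; last first.
  by move=> _ [y [z ->]]; rewrite lie_morph; apply: derived_lie.
by split=> [|a y z Dy Dz]; rewrite ?linear0 // linearP; apply: DD.
Qed.

(* f' : L' -> M' *)
Definition derived_map (u : derived_alg L) : derived_alg M :=
  DerivedAlg (mem_set (derived_morph (derived_valP u))).

End DerivedMap.


Section LieQuotient.
Variables (C : comPzRingType) (L : lieAlgType C) (S : set L).

Definition lie_equiv (x y : L) : bool := `[< ideal_gen S (x - y) >].

Let sI : is_submodule (ideal_gen S) := proj1 (ideal_genP S).

Fact lie_equiv_equiv : equiv_class_of lie_equiv.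
Proof.
split=> [x|x y|y x z].
- by apply/asboolP; rewrite subrr; apply: (submodule0 sI).
- by apply: asbool_equiv_eq; split=> h; rewrite -opprB; apply: (submoduleN sI).
- move=> /asboolP h /asboolP h'; apply/asboolP.
  by rewrite -(subrK y x) -addrA; apply: (submoduleD sI).
Qed.

Canonical lie_equiv_rel := EquivRelPack lie_equiv_equiv.
Canonical lie_equiv_direct := defaultEncModRel lie_equiv_rel.

Definition lie_quot := {eq_quot lie_equiv_direct}.

HB.instance Definition _ := Choice.on lie_quot.

Local Notation Q := lie_quot.
Local Notation pq := (\pi_{eq_quot lie_equiv_direct} : L -> Q).

Let eqQ x y : (pq x = pq y) <-> ideal_gen S (x - y).
Proof.
split=> [/eqmodP/asboolP //|h]; apply/eqmodP; exact/asboolP.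
Qed.

Let reprQ x : ideal_gen S (repr (pq x) - x).
Proof. by apply/eqQ; rewrite reprK. Qed.

Let zeroQ : Q := pq 0.
Let oppQ (u : Q) : Q := pq (- repr u).
Let addQ (u v : Q) : Q := pq (repr u + repr v).
Let scaleQ a (u : Q) : Q := pq (a *: repr u).
Let brQ (u v : Q) : Q := pq [lie repr u, repr v].

Let oppQE x : oppQ (pq x) = pq (- x).
Proof. by apply/eqQ; rewrite -opprD; apply: (submoduleN sI); last exact: reprQ. Qed.

Let addQE x y : addQ (pq x) (pq y) = pq (x + y).
Proof. by apply/eqQ; rewrite opprD addrACA; apply: (submoduleD sI). Qed.

Let scaleQE a x : scaleQ a (pq x) = pq (a *: x).
Proof. by apply/eqQ; rewrite -scalerBr; apply: (submoduleZ _ sI). Qed.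

Let brQE x y : brQ (pq x) (pq y) = pq [lie x, y].
Proof.
have [_ iI] := ideal_genP S; apply/eqQ; set x' := repr _; set y' := repr _.
suff -> : [lie x', y'] - [lie x, y] = [lie x', y' - y] - [lie y, x' - x].
  by apply: (submoduleD sI) => //; [|apply: (submoduleN sI) => //]; apply: iI; apply: reprQ.
rewrite !lieDr -!scaleN1r !lieZr !scaleN1r (lieC y x') (lieC y x) !opprD !opprK.
by rewrite addrA addrNK.
Qed.

Let elimQ (P : Q -> Prop) : (forall x, P (pq x)) -> forall u, P u.
Proof. by move=> h u; rewrite -[u]reprK. Qed.

Fact lie_quot_addA : associative addQ.
Proof.
by do 3![elim/elimQ => ?]; rewrite !addQE addrA.
Qed.
Fact lie_quot_addC : commutative addQ.
Proof. by do 2![elim/elimQ => ?]; rewrite !addQE addrC. Qed.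
Fact lie_quot_add0 : left_id zeroQ addQ.
Proof. by elim/elimQ => ?; rewrite !addQE add0r. Qed.
Fact lie_quot_addN : left_inverse zeroQ oppQ addQ.
Proof. by elim/elimQ => ?; rewrite oppQE !addQE addNr. Qed.

HB.instance Definition _ := GRing.isZmodule.Build lie_quot
  lie_quot_addA lie_quot_addC lie_quot_add0 lie_quot_addN.

Let piD x y : pq x + pq y = pq (x + y). Proof. exact: addQE. Qed.

Fact lie_quot_scaleA a b u : scaleQ a (scaleQ b u) = scaleQ (a * b) u.
Proof. by elim/elimQ: u => ?; rewrite !scaleQE scalerA. Qed.
Fact lie_quot_scale1 : left_id 1 scaleQ.
Proof. by elim/elimQ => ?; rewrite scaleQE scale1r. Qed.
Fact lie_quot_scaleDr : right_distributive scaleQ +%R.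
Proof. by move=> a; do 2![elim/elimQ => ?]; rewrite piD !scaleQE piD scalerDr. Qed.
Fact lie_quot_scaleDl u : {morph scaleQ^~ u : a b / a + b}.
Proof. by elim/elimQ: u => ? a b; rewrite /= !scaleQE piD scalerDl. Qed.

HB.instance Definition _ := GRing.Zmodule_isLmodule.Build C lie_quot
  lie_quot_scaleA lie_quot_scale1 lie_quot_scaleDr lie_quot_scaleDl.

Let piZ a x : a *: pq x = pq (a *: x). Proof. exact: scaleQE. Qed.

Fact lie_quot_linl a u v w : brQ (a *: u + v) w = a *: brQ u w + brQ v w.
Proof.
by elim/elimQ: u => ?; elim/elimQ: v => ?; elim/elimQ: w => ?;
   rewrite piZ piD !brQE piZ piD lie_linl.
Qed.
Fact lie_quot_linr a u v w : brQ u (a *: v + w) = a *: brQ u v + brQ u w.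
Proof.
by elim/elimQ: u => ?; elim/elimQ: v => ?; elim/elimQ: w => ?;
   rewrite piZ piD !brQE piZ piD lie_linr.
Qed.
Fact lie_quot_alt u : brQ u u = 0.
Proof. by elim/elimQ: u => ?; rewrite brQE lie_alt. Qed.
Fact lie_quot_jacobi u v w :
  brQ u (brQ v w) + brQ v (brQ w u) + brQ w (brQ u v) = 0.
Proof.
by elim/elimQ: u => ?; elim/elimQ: v => ?; elim/elimQ: w => ?;
   rewrite !brQE !piD lie_jacobi.
Qed.

HB.instance Definition _ := isLie.Build C lie_quot
  lie_quot_linl lie_quot_linr lie_quot_alt lie_quot_jacobi.

Definition lie_pi (x : L) : lie_quot := pq x.

Fact lie_pi_linear : linear lie_pi.
Proof. by move=> a x y; rewrite /lie_pi piZ piD. Qed.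
Fact lie_pi_lie x y : lie_pi [lie x, y] = [lie lie_pi x, lie_pi y].
Proof. by apply/esym; exact: brQE. Qed.

HB.instance Definition _ := GRing.isLinear.Build C L lie_quot *:%R lie_pi
  lie_pi_linear.
HB.instance Definition _ := isLieMorphism.Build C L lie_quot lie_pi lie_pi_lie.

Lemma lie_pi_eq0 x : lie_pi x = 0 <-> ideal_gen S x.
Proof. by rewrite -[x in ideal_gen S x]subr0 -eqQ. Qed.

Lemma lie_pi_rel x : S x -> lie_pi x = 0.
Proof. by move=> Sx; apply/lie_pi_eq0 => T [_]; apply. Qed.

Lemma lie_pi_surj u : exists x, lie_pi x = u.
Proof. by exists (repr u); apply: reprK. Qed.

End LieQuotient.

Section LieQuotientLift.
Variables (C : comPzRingType) (L M : lieAlgType C) (S : set L).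
Variables (f : {lie L -> M}) (fS : forall x, S x -> f x = 0).

Lemma quot_lift_ideal x : ideal_gen S x -> f x = 0.
Proof.
move=> /(_ (fun y => f y = 0)); apply; split=> //; split; first split.
- exact: linear0.
- by move=> a y z fy fz; rewrite linearP /= fy fz scaler0 addr0.
- by move=> y z fz; rewrite lie_morph fz lie0r.
Qed.

(* the morphism L / <S> -> M induced by f *)
Definition quot_lift (u : lie_quot S) : M := f (repr u).

Lemma quot_liftE x : quot_lift (lie_pi S x) = f x.
Proof.
apply/eqP; rewrite -subr_eq0 -raddfB; apply/eqP/quot_lift_ideal.
by apply/lie_pi_eq0; rewrite linearB /=; apply/eqP; rewrite subr_eq0 /lie_pi reprK.
Qed.

Fact quot_lift_linear : linear quot_lift.
Proof.
move=> a u v; have [x <-] := lie_pi_surj u; have [y <-] := lie_pi_surj v.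
by rewrite -linearP !quot_liftE linearP.
Qed.
Fact quot_lift_lie u v : quot_lift [lie u, v] = [lie quot_lift u, quot_lift v].
Proof.
have [x <-] := lie_pi_surj u; have [y <-] := lie_pi_surj v.
by rewrite -lie_morph !quot_liftE lie_morph.
Qed.

Definition quot_lift_hom : {lie lie_quot S -> M} :=
  HB.pack quot_lift
    (GRing.isLinear.Build C (lie_quot S) M *:%R quot_lift quot_lift_linear)
    (isLieMorphism.Build C (lie_quot S) M quot_lift quot_lift_lie).

End LieQuotientLift.


(* The free Lie algebra on V is the algebra of formal expressions in the
   elements of V modulo the congruence generated by the axioms of C-Lie
   algebras; its universal property is given by free_lift, free_liftE and
   free_lift_uniq. *)

Inductive lie_term (C V : Type) : Type :=
| LVar of V
| LZero
| LAdd of lie_term C V & lie_term C V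
| LOpp of lie_term C V
| LScale of C & lie_term C V
| LBr of lie_term C V & lie_term C V.
Arguments LVar {C V}.
Arguments LZero {C V}.

HB.instance Definition _ (C V : Type) := gen_eqMixin (lie_term C V).
HB.instance Definition _ (C V : Type) := gen_choiceMixin (lie_term C V).

Inductive lie_cong (C : comPzRingType) (V : Type) :
    lie_term C V -> lie_term C V -> Prop :=
| lc_refl t : lie_cong t t
| lc_sym t u : lie_cong t u -> lie_cong u t
| lc_trans t u v : lie_cong t u -> lie_cong u v -> lie_cong t v
| lc_add t t' u u' : lie_cong t t' -> lie_cong u u' ->
    lie_cong (LAdd t u) (LAdd t' u')
| lc_opp t t' : lie_cong t t' -> lie_cong (LOpp t) (LOpp t')
| lc_scale a t t' : lie_cong t t' -> lie_cong (LScale a t) (LScale a t')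
| lc_br t t' u u' : lie_cong t t' -> lie_cong u u' ->
    lie_cong (LBr t u) (LBr t' u')
| lc_addA t u v : lie_cong (LAdd t (LAdd u v)) (LAdd (LAdd t u) v)
| lc_addC t u : lie_cong (LAdd t u) (LAdd u t)
| lc_add0 t : lie_cong (LAdd LZero t) t
| lc_addN t : lie_cong (LAdd (LOpp t) t) LZero
| lc_scaleA a b t : lie_cong (LScale a (LScale b t)) (LScale (a * b) t)
| lc_scale1 t : lie_cong (LScale 1 t) t
| lc_scaleDr a t u :
    lie_cong (LScale a (LAdd t u)) (LAdd (LScale a t) (LScale a u))
| lc_scaleDl a b t :
    lie_cong (LScale (a + b) t) (LAdd (LScale a t) (LScale b t))
| lc_linl a t u v :
    lie_cong (LBr (LAdd (LScale a t) u) v) (LAdd (LScale a (LBr t v)) (LBr u v))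
| lc_linr a t u v :
    lie_cong (LBr t (LAdd (LScale a u) v)) (LAdd (LScale a (LBr t u)) (LBr t v))
| lc_alt t : lie_cong (LBr t t) LZero
| lc_jacobi t u v :
    lie_cong (LAdd (LAdd (LBr t (LBr u v)) (LBr u (LBr v t))) (LBr v (LBr t u)))
             LZero.

Section FreeLie.
Variables (C : comPzRingType) (V : Type).
Local Notation term := (lie_term C V).

Definition lie_congb (t u : term) : bool := `[< lie_cong t u >].

Fact lie_congb_equiv : equiv_class_of lie_congb.
Proof.
split=> [t|t u|u t v]; first exact/asboolP/lc_refl.
  by apply: asbool_equiv_eq; split; apply: lc_sym.
by move=> /asboolP h /asboolP h'; apply/asboolP; apply: lc_trans h h'.
Qed.

Canonical lie_congb_rel := EquivRelPack lie_congb_equiv.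
Canonical lie_congb_direct := defaultEncModRel lie_congb_rel.

Definition freeLie := {eq_quot lie_congb_direct}.

HB.instance Definition _ := Choice.on freeLie.

Local Notation F := freeLie.
Local Notation pf := (\pi_{eq_quot lie_congb_direct} : term -> F).

Let eqF t u : (pf t = pf u) <-> lie_cong t u.
Proof. by split=> [/eqmodP/asboolP //|h]; apply/eqmodP; exact/asboolP. Qed.

Let reprF t : lie_cong (repr (pf t)) t.
Proof. by apply/eqF; rewrite reprK. Qed.

Let zeroF : F := pf LZero.
Let oppF (x : F) : F := pf (LOpp (repr x)).
Let addF (x y : F) : F := pf (LAdd (repr x) (repr y)).
Let scaleF a (x : F) : F := pf (LScale a (repr x)).
Let brF (x y : F) : F := pf (LBr (repr x) (repr y)).

Let oppFE t : oppF (pf t) = pf (LOpp t).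
Proof. by apply/eqF/lc_opp/reprF. Qed.
Let addFE t u : addF (pf t) (pf u) = pf (LAdd t u).
Proof. by apply/eqF/lc_add; apply: reprF. Qed.
Let scaleFE a t : scaleF a (pf t) = pf (LScale a t).
Proof. by apply/eqF/lc_scale/reprF. Qed.
Let brFE t u : brF (pf t) (pf u) = pf (LBr t u).
Proof. by apply/eqF/lc_br; apply: reprF. Qed.

Let elimF (P : F -> Prop) : (forall t, P (pf t)) -> forall x, P x.
Proof. by move=> h x; rewrite -[x]reprK. Qed.

Fact freeLie_addA : associative addF.
Proof.
by do 3![elim/elimF => ?]; rewrite !addFE; apply/eqF/lc_addA.
Qed.
Fact freeLie_addC : commutative addF.
Proof. by do 2![elim/elimF => ?]; rewrite !addFE; apply/eqF/lc_addC. Qed.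
Fact freeLie_add0 : left_id zeroF addF.
Proof. by elim/elimF => ?; rewrite !addFE; apply/eqF/lc_add0. Qed.
Fact freeLie_addN : left_inverse zeroF oppF addF.
Proof. by elim/elimF => ?; rewrite oppFE !addFE; apply/eqF/lc_addN. Qed.

HB.instance Definition _ := GRing.isZmodule.Build freeLie
  freeLie_addA freeLie_addC freeLie_add0 freeLie_addN.

Let piD t u : pf t + pf u = pf (LAdd t u). Proof. exact: addFE. Qed.

Fact freeLie_scaleA a b x : scaleF a (scaleF b x) = scaleF (a * b) x.
Proof. by elim/elimF: x => ?; rewrite !scaleFE; apply/eqF/lc_scaleA. Qed.
Fact freeLie_scale1 : left_id 1 scaleF.
Proof. by elim/elimF => ?; rewrite scaleFE; apply/eqF/lc_scale1. Qed.
Fact freeLie_scaleDr : right_distributive scaleF +%R.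
Proof.
by move=> a; do 2![elim/elimF => ?]; rewrite piD !scaleFE piD; apply/eqF/lc_scaleDr.
Qed.
Fact freeLie_scaleDl x : {morph scaleF^~ x : a b / a + b}.
Proof.
by elim/elimF: x => ? a b; rewrite /= !scaleFE piD; apply/eqF/lc_scaleDl.
Qed.

HB.instance Definition _ := GRing.Zmodule_isLmodule.Build C freeLie
  freeLie_scaleA freeLie_scale1 freeLie_scaleDr freeLie_scaleDl.

Let piZ a t : a *: pf t = pf (LScale a t). Proof. exact: scaleFE. Qed.

Fact freeLie_linl a x y z : brF (a *: x + y) z = a *: brF x z + brF y z.
Proof.
elim/elimF: x => ?; elim/elimF: y => ?; elim/elimF: z => ?.
by rewrite piZ piD !brFE piZ piD; apply/eqF/lc_linl.
Qed.
Fact freeLie_linr a x y z : brF x (a *: y + z) = a *: brF x y + brF x z.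
Proof.
elim/elimF: x => ?; elim/elimF: y => ?; elim/elimF: z => ?.
by rewrite piZ piD !brFE piZ piD; apply/eqF/lc_linr.
Qed.
Fact freeLie_alt x : brF x x = 0.
Proof. by elim/elimF: x => ?; rewrite brFE; apply/eqF/lc_alt. Qed.
Fact freeLie_jacobi x y z :
  brF x (brF y z) + brF y (brF z x) + brF z (brF x y) = 0.
Proof.
elim/elimF: x => ?; elim/elimF: y => ?; elim/elimF: z => ?.
by rewrite !brFE !piD; apply/eqF/lc_jacobi.
Qed.

HB.instance Definition _ := isLie.Build C freeLie
  freeLie_linl freeLie_linr freeLie_alt freeLie_jacobi.

Definition free_gen (v : V) : freeLie := pf (LVar v).

Lemma freeLie_ind (P : freeLie -> Prop) :
  (forall v, P (free_gen v)) -> P 0 ->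
  (forall a x y, P x -> P y -> P (a *: x + y)) ->
  (forall x y, P x -> P y -> P [lie x, y]) -> forall x, P x.
Proof.
move=> Pv P0 PL PB; elim/elimF; elim=> [v||t Pt u Pu|t Pt|a t Pt|t Pt u Pu].
- exact: Pv.
- exact: P0.
- by have := PL 1 _ _ Pt Pu; rewrite scale1r piD.
- by have := PL (-1) _ _ Pt P0; rewrite scaleN1r addr0 -[- _]/(oppF _) oppFE.
- by have := PL a _ _ Pt P0; rewrite addr0 piZ.
- by have := PB _ _ Pt Pu; rewrite -[lie_br _ _]/(brF _ _) brFE.
Qed.

Section Lift.
Variables (L : lieAlgType C) (f : V -> L).

Fixpoint term_eval (t : term) : L :=
  match t with
  | LVar v => f v
  | LZero => 0
  | LAdd t u => term_eval t + term_eval u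
  | LOpp t => - term_eval t
  | LScale a t => a *: term_eval t
  | LBr t u => [lie term_eval t, term_eval u]
  end.

Lemma term_eval_cong t u : lie_cong t u -> term_eval t = term_eval u.
Proof.
elim=> //=; do ?[by move=> *; congruence].
- by move=> *; rewrite addrA.
- by move=> *; rewrite addrC.
- by move=> *; rewrite add0r.
- by move=> *; rewrite addNr.
- by move=> *; rewrite scalerA.
- by move=> *; rewrite scale1r.
- by move=> *; rewrite scalerDr.
- by move=> *; rewrite scalerDl.
- by move=> *; rewrite lie_linl.
- by move=> *; rewrite lie_linr.
- by move=> *; rewrite lie_alt.
- by move=> *; rewrite lie_jacobi.
Qed.

Definition free_lift_fun (x : freeLie) : L := term_eval (repr x).

Let liftE t : free_lift_fun (pf t) = term_eval t.
Proof. exact/term_eval_cong/reprF. Qed.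

Fact free_lift_linear : linear free_lift_fun.
Proof.
move=> a x y; elim/elimF: x => t; elim/elimF: y => u.
by rewrite piZ piD !liftE.
Qed.
Fact free_lift_lie x y :
  free_lift_fun [lie x, y] = [lie free_lift_fun x, free_lift_fun y].
Proof.
elim/elimF: x => t; elim/elimF: y => u.
by rewrite -[ [lie _, _] in LHS]/(brF _ _) brFE !liftE.
Qed.

Definition free_lift : {lie freeLie -> L} :=
  HB.pack free_lift_fun
    (GRing.isLinear.Build C freeLie L *:%R free_lift_fun free_lift_linear)
    (isLieMorphism.Build C freeLie L free_lift_fun free_lift_lie).

Lemma free_liftE v : free_lift (free_gen v) = f v.
Proof. exact: liftE. Qed.

Lemma free_lift_uniq (g : {lie freeLie -> L}) :
  (forall v, g (free_gen v) = f v) -> g =1 free_lift.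
Proof.
move=> gf; elim/freeLie_ind=> [v||a x y gx gy|x y gx gy].
- by rewrite gf free_liftE.
- by rewrite !linear0.
- by rewrite !linearP; congr (_ *: _ + _).
- by rewrite !lie_morph gx gy.
Qed.

End Lift.

(* The degree m part of the free Lie algebra when each generator v is given
   the degree d v *)
Inductive homogeneous (d : V -> nat) : nat -> freeLie -> Prop :=
| homog_gen v : homogeneous d (d v) (free_gen v)
| homog_br m n x y : homogeneous d m x -> homogeneous d n y ->
    homogeneous d (m + n) [lie x, y]
| homog0 m : homogeneous d m 0
| homog_lin m a x y : homogeneous d m x -> homogeneous d m y ->
    homogeneous d m (a *: x + y).

Definition homogeneous_ideal (d : V -> nat) (I : set freeLie) : Prop :=
  forall x, I x -> exists (N : nat) (c : 'I_N -> freeLie),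
    (forall m : 'I_N, homogeneous d m (c m) /\ I (c m)) /\ x = \sum_(m < N) c m.

End FreeLie.
Arguments free_gen {C V} v.

Definition free_map (C : comPzRingType) (V W : Type) (h : V -> W) :
  {lie freeLie C V -> freeLie C W} := free_lift (free_gen \o h).

Lemma free_mapE (C : comPzRingType) (V W : Type) (h : V -> W) v :
  free_map C h (free_gen v) = free_gen (h v).
Proof. exact: free_liftE. Qed.


Definition supp (X : finType) (B : {set {set X}}) : {set X} :=
  (\bigcup_(D in B) D)%SET.

Record set_arrangement (X : finType) := SetArrangement {
  arr_sets :> {set {set X}};
  arr_card : (2 <= #|X|)%N;
  arr_ge2 : forall A, A \in arr_sets -> (2 <= #|A|)%N;
  arr_meet : forall A B, A \in arr_sets -> B \in arr_sets -> A != B ->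
    (#|A :&: B| <= 1)%N;
  arr_full : supp arr_sets = [set: X]%SET
}.

Record closed_sub (X : finType) (A : set_arrangement X) := ClosedSub {
  csub_sets :> {set {set X}};
  csub_sub : csub_sets \subset A;
  csub_closed : forall D, D \in A -> D \notin csub_sets ->
    (#|D :&: supp csub_sets| <= 1)%N
}.

Notation elt A := {x | x \in A}.

Definition elt_incl (X : finType) (A B : {set X}) (AB : A \subset B) (x : elt A) :
  elt B := exist _ (val x) (fintype.subsetP AB _ (valP x)).

Definition freeOn (C : comPzRingType) (X : finType) (A : {set X}) :
  lieAlgType C := freeLie C (elt A).

(* the canonical maps F(A) -> F(B), for A included in B, and F(A) -> F(X) *)
Definition freeOn_incl (C : comPzRingType) (X : finType) (A B : {set X})
    (AB : A \subset B) : {lie freeOn C A -> freeOn C B} :=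
  free_map C (elt_incl AB).
Definition freeOn_val (C : comPzRingType) (X : finType) (A : {set X}) :
  {lie freeOn C A -> freeLie C X} := free_map C val.

(* The data defining a Lie algebra of the set-arrangement A: the sets R_D, for
   D in A (the values of arr_rel outside A are irrelevant). *)
Record arr_lie_data (C : comPzRingType) (X : finType) (A : set_arrangement X) :=
  ArrLieData {
    arr_rel : forall D : {set X}, set (freeOn C D);
    arr_rel_derived : forall D, D \in A ->
      forall r : freeOn C D, arr_rel r -> derived _ r
  }.
Arguments arr_rel {C X A} R D _ : rename.

Section ArrangementLie.
Variables (C : comPzRingType) (X : finType) (A : set_arrangement X).
Variable R : arr_lie_data C A.

Definition arr_relations : set (freeLie C X) := fun u =>
  (exists x y : X, (forall D, D \in A -> ~~ ([set x; y]%SET \subset D)) /\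
     u = [lie free_gen x, free_gen y]) \/
  (exists2 D, D \in A & exists2 r, arr_rel R D r & u = freeOn_val C D r).

Definition arr_lie : lieAlgType C := lie_quot arr_relations.

Definition arr_gen (x : X) : arr_lie := lie_pi arr_relations (free_gen x).

(* L_D, for D in A *)
Definition loc_lie (D : {set X}) : lieAlgType C := lie_quot (arr_rel R D).

Definition loc_gen (D : {set X}) (x : elt D) : loc_lie D :=
  lie_pi (arr_rel R D) (free_gen x).

Definition replacement_condition : Prop :=
  forall D : {set X}, D \in A -> (3 <= #|D|)%N ->
  forall x : X, x \in D -> (exists2 B, B \in A & B != D /\ x \in B) ->
  (derived (loc_lie D) `<=`
     subalgebra_gen (fun u => exists2 y : elt D, val y != x & u = loc_gen y))%classic.

Definition graded_by_positive_degrees : Prop :=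
  exists d : X -> nat, (forall x, (0 < d x)%N) /\
    homogeneous_ideal d (ideal_gen arr_relations).

Section Closed.
Variable B : closed_sub A.

Definition csub_relations : set (freeOn C (supp B)) := fun u =>
  (exists x y : elt (supp B),
     (forall D, D \in (B : {set {set X}}) ->
        ~~ ([set val x; val y]%SET \subset D)) /\
     u = [lie free_gen x, free_gen y]) \/
  (exists (D : {set X}) (DB : D \in (B : {set {set X}})),
     exists2 r, arr_rel R D r & u = freeOn_incl C (finset.bigcup_sup D DB) r).

Definition csub_lie : lieAlgType C := lie_quot csub_relations.

Definition csub_gen (x : elt (supp B)) : csub_lie :=
  lie_pi csub_relations (free_gen x).

Definition s_free : {lie freeOn C (supp B) -> arr_lie} :=
  free_lift (fun x => arr_gen (val x)).

Definition pi_free : {lie freeLie C X -> csub_lie} :=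
  free_lift (fun x => if insub x is Some y then csub_gen y else 0).

Lemma s_free_rel u : csub_relations u -> s_free u = 0.
Proof.
case=> [[x [y [xy ->]]]|[D [DB [r Rr ->]]]].
- rewrite lie_morph !free_liftE -lie_morph.
  have [<-|neq_xy] := eqVneq x y; first by rewrite lie_alt linear0.
  apply: lie_pi_rel; left; exists (val x), (val y); split=> // D DA.
  apply/negP=> xyD; have [DB|DB] := boolP (D \in (B : {set {set X}})).
    by have /negP := xy _ DB.
  have := csub_closed DA DB; apply/negP; rewrite -ltnNge.
  rewrite (leq_trans _ (subset_leq_card (_ : [set val x; val y]%SET \subset _))) //.
    by rewrite cards2 (inj_eq val_inj) neq_xy.
  by rewrite finset.subsetI xyD; apply/fintype.subsetP=> z /finset.set2P[]->; apply: valP.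
- have DA : D \in A := fintype.subsetP (csub_sub B) _ DB.
  have -> : s_free (freeOn_incl C (finset.bigcup_sup D DB) r)
            = lie_pi arr_relations (freeOn_val C D r).
    elim/freeLie_ind: r {Rr} => [v||a x y gx gy|x y gx gy].
    + by rewrite !free_mapE free_liftE.
    + by rewrite !linear0.
    + by rewrite !linearP; congr (_ *: _ + _).
    + by rewrite !lie_morph gx gy.
  by apply: lie_pi_rel; right; exists D => //; exists r.
Qed.

(* s_B : L_B -> L *)
Definition s_map : {lie csub_lie -> arr_lie} := quot_lift_hom s_free_rel.

Lemma s_mapE x : s_map (csub_gen x) = arr_gen (val x).
Proof. exact: etrans (quot_liftE s_free_rel _) (free_liftE _ _). Qed.

Lemma pi_free_rel u : arr_relations u -> pi_free u = 0.
Proof.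
case=> [[x [y [xy ->]]]|[D DA [r Rr ->]]].
- rewrite lie_morph !free_liftE.
  case: insubP => [x' _ ex|_]; last by rewrite lie0l.
  case: insubP => [y' _ ey|_]; last by rewrite lie0r.
  rewrite -lie_morph; apply: lie_pi_rel; left; exists x', y'.
  by split=> // D DB; rewrite ex ey; apply: xy; apply: fintype.subsetP (csub_sub B) _ DB.
have [DB|DB] := boolP (D \in (B : {set {set X}})).
  have -> : pi_free (freeOn_val C D r)
            = lie_pi csub_relations (freeOn_incl C (finset.bigcup_sup D DB) r).
    elim/freeLie_ind: r {Rr} => [v||a x y gx gy|x y gx gy].
    + rewrite !free_mapE free_liftE; case: insubP => [y _ ey|/negP[]].
        by congr (lie_pi _ (free_gen _)); apply: val_inj.
      exact: valP (elt_incl (finset.bigcup_sup D DB) v).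
    + by rewrite !linear0.
    + by rewrite !linearP; congr (_ *: _ + _).
    + by rewrite !lie_morph gx gy.
  by apply: lie_pi_rel; right; exists D, DB; exists r.
(* here at most one generator of D survives, so the image of F(D) is a line *)
pose h (x : freeOn C D) : csub_lie := pi_free (freeOn_val C D x).
have h0 : h 0 = 0 by rewrite /h !linear0.
have hL a x y : h (a *: x + y) = a *: h x + h y by rewrite /h !linearP.
have hB x y : h [lie x, y] = [lie h x, h y] by rewrite /h !lie_morph.
have hv v : h (free_gen v) = if insub (val v) is Some y then csub_gen y else 0.
  by rewrite /h free_mapE free_liftE.
have [g Hg] : exists g, forall x, exists a : C, h x = a *: g.
  pose g0 := [pick z in D :&: supp B].
  exists (if g0 is Some z then if insub z is Some y then csub_gen y else 0 else 0).
  elim/freeLie_ind=> [v||a x y [b gx] [c gy]|x y [b gx] [c gy]].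
  - rewrite hv /g0; case: pickP => [z zDB|DB0]; case: insubP => [y yB ey|_].
    + exists 1; rewrite scale1r; suff -> : z = val v by rewrite -ey valK.
      by apply: (card_le1_eqP (csub_closed DA DB)) => //; rewrite inE yB (valP v).
    + by exists 0; rewrite scale0r.
    + by have := DB0 (val v); rewrite inE yB (valP v).
    + by exists 0; rewrite scale0r.
  - by exists 0; rewrite h0 scale0r.
  - by exists (a * b + c); rewrite hL gx gy scalerDl scalerA.
  - by exists 0; rewrite hB gx gy lieZl lieZr lie_alt !scaler0 scale0r.
rewrite -/(h r); have := arr_rel_derived DA Rr.
move=> /(_ (fun x => h x = 0)); apply; split; first split=> //.
- by move=> a x y hx hy; rewrite hL hx hy scaler0 addr0.
- move=> _ [x [y ->]]; rewrite hB; have [[a ->] [b ->]] := (Hg x, Hg y).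
  by rewrite lieZl lieZr lie_alt !scaler0.
Qed.

(* pi_B : L -> L_B *)
Definition pi_map : {lie arr_lie -> csub_lie} := quot_lift_hom pi_free_rel.

Lemma pi_mapE (x : elt (supp B)) : pi_map (arr_gen (val x)) = csub_gen x.
Proof. by apply: etrans (quot_liftE pi_free_rel _) _; rewrite free_liftE valK. Qed.

Lemma pi_mapE0 x : x \notin supp B -> pi_map (arr_gen x) = 0.
Proof.
move=> xB; apply: etrans (quot_liftE pi_free_rel _) _.
by rewrite free_liftE insubN.
Qed.

(* im(s_B') as a subset of L *)
Definition im_s' : set arr_lie := (s_map @` derived csub_lie)%classic.

End Closed.

Section Sum.
Variables (k : nat) (B : 'I_k -> closed_sub A).

(* the direct sum of the modules L_{B_i}' over the finite index set 'I_k *)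
Definition dsum_derived : Type := forall i : 'I_k, derived_alg (csub_lie (B i)).

Definition s'_map (u : dsum_derived) : derived_alg arr_lie :=
  \sum_(i < k) derived_map (s_map (B i)) (u i).

Definition pi'_map (v : derived_alg arr_lie) : dsum_derived :=
  fun i => derived_map (pi_map (B i)) v.

Definition sum_im_s' : set arr_lie := fun u =>
  exists f : 'I_k -> arr_lie, (forall i, im_s' (B i) (f i)) /\ u = \sum_(i < k) f i.

End Sum.

End ArrangementLie.

Arguments im_s' {C X A} R B _.
Arguments sum_im_s' {C X A} R {k} B _.
Arguments dsum_derived {C X A} R {k} B.
Arguments s'_map {C X A} R {k} B u.
Arguments pi'_map {C X A} R {k} B v _.

(* Main.v *)
Require Import Defs.
From HB Require Import structures.
From mathcomp Require Import all_boot all_order all_algebra.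
From mathcomp Require Import boolp classical_sets functions.

Set Implicit Arguments.
Unset Strict Implicit.
Unset Printing Implicit Defensive.

Import GRing.Theory.
Local Open Scope ring_scope.

(* Two generators common to supp B_i and supp B_j, i != j, commute, hence pi' is
   a left inverse of s'. This gives 4 => 5, and 5 => 6 because every pi_{B_j}
   kills [x, [y, z]]; 1 => 2 => 3 => 4 are formal.
   For 6 => 1, fix B = B_i, let S = supp B, and let Z be the subalgebra of the w
   commuting with all x outside S. For w in Z, y in S and x outside S one has
   [x, [y, w]] = [[x, y], w], which vanishes by replacement unless {x, y} is in
   A. For such a pair, replacement at the sets of B containing y shows that the
   derived algebra of <S> lies in that of <S \ y>; here one uses that L' meets
   the span of the generators trivially. Under (ii) a single pair has to be
   avoided, so the derived algebra of <S \ y> lies in Z at once. Under (i) the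
   element y to avoid depends on x, and one inducts on the degree. *)

(** * Subalgebras and derived algebras *)

Section LieIdentities.
Variables (C : comPzRingType) (L : lieAlgType C).
Implicit Types x y z : L.

Lemma lieNr x y : [lie x, - y] = - [lie x, y].
Proof. by rewrite -scaleN1r lieZr scaleN1r. Qed.

Lemma lie_leibniz x y z : [lie x, [lie y, z]] = [lie [lie x, y], z] + [lie y, [lie x, z]].
Proof.
have := lie_jacobi x y z.
rewrite (lieC z x) lieNr (lieC z) => /eqP.
by rewrite subr_eq0 subr_eq => /eqP.
Qed.

Lemma lie_leibnizl x y z : [lie [lie x, y], z] = [lie x, [lie y, z]] - [lie y, [lie x, z]].
Proof. by rewrite lie_leibniz addrK. Qed.

Lemma lie_sumr (I : Type) (s : seq I) (P : pred I) x (F : I -> L) :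
  [lie x, \sum_(i <- s | P i) F i] = \sum_(i <- s | P i) [lie x, F i].
Proof. by apply: (big_morph (fun y => [lie x, y])); [exact: lieDr | exact: lie0r]. Qed.

End LieIdentities.

Section Subalgebras.
Variables (C : comPzRingType) (L : lieAlgType C).
Implicit Types (N S : set L).

Lemma submodule_sum S (I : Type) (s : seq I) (P : pred I) (F : I -> L) :
  is_submodule S -> (forall i, P i -> S (F i)) -> S (\sum_(i <- s | P i) F i).
Proof.
move=> sS SF; apply: (big_ind S) => //; first exact: submodule0.
by move=> x y; apply: submoduleD.
Qed.

Lemma submodule_lier N x : is_submodule N -> is_submodule (fun u => N [lie x, u]).
Proof. by case=> N0 NL; split=> [|a u v Nu Nv]; rewrite ?lie0r // lie_linr; apply: NL. Qed.

Lemma span_sub S N : is_submodule N -> (forall x, S x -> N x) -> forall x, span_gen S x -> N x.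
Proof. by move=> sN SN x; apply. Qed.

Lemma span_gen_subalgebra S : (forall x y, S x -> S y -> span_gen S [lie x, y]) ->
  is_lie_subalgebra (span_gen S).
Proof.
move=> SB; have sS := span_genP S; split=> // x y Sx; move: y.
apply: span_sub; first exact: submodule_lier.
move=> y Sy; move: x Sx; apply: span_sub => [|x Sx]; last exact: SB.
split=> [|a x x' Sx Sx']; rewrite ?lie0l; first exact: submodule0.
by rewrite lie_linl; apply: sS.2.
Qed.

Lemma subalgebra_sub S N : is_lie_subalgebra N -> (forall x, S x -> N x) ->
  forall x, subalgebra_gen S x -> N x.
Proof. by move=> sN SN x; apply. Qed.

Lemma subalgebra_gen_sub S x : S x -> subalgebra_gen S x.
Proof. by move=> Sx; apply: sub_gen_smallest. Qed.

Lemma subalgebra_mono S N : (forall x, S x -> N x) ->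
  forall x, subalgebra_gen S x -> subalgebra_gen N x.
Proof.
move=> SN; apply: subalgebra_sub; first exact: subalgebra_genP.
by move=> x /SN; apply: subalgebra_gen_sub.
Qed.

(** The commutators of [S] are taken inside [L], so that derived algebras of different subalgebras
    can be compared as subsets of [L]. *)
Definition derived_of S : set L :=
  span_gen (fun u => exists x y, [/\ S x, S y & u = [lie x, y]]).

Lemma derived_of_lie S x y : S x -> S y -> derived_of S [lie x, y].
Proof. by move=> Sx Sy; apply: sub_gen_smallest; exists x, y. Qed.

Lemma derived_of_submodule S : is_submodule (derived_of S).
Proof. exact: span_genP. Qed.

Lemma derived_of_sub S : is_lie_subalgebra S -> forall u, derived_of S u -> S u.
Proof. by case=> sS SB; apply: span_sub => // _ [x [y [Sx Sy ->]]]; apply: SB. Qed.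

Lemma derived_of_derived S u : derived_of S u -> derived L u.
Proof.
apply: span_sub; first exact: derived_submodule.
by move=> _ [x [y [_ _ ->]]]; apply: derived_lie.
Qed.

Lemma centralizer_subalgebra S :
  is_lie_subalgebra (fun w => forall x, S x -> [lie x, w] = 0).
Proof.
split; first split=> [x _|a u v Zu Zv x Sx]; first exact: lie0r.
  by rewrite lie_linr Zu // Zv // scaler0 addr0.
by move=> u v Zu Zv x Sx; rewrite lie_leibniz (Zu x Sx) (Zv x Sx) lie0l lie0r addr0.
Qed.

Lemma normalizer_subalgebra N : is_submodule N ->
  is_lie_subalgebra (fun x => forall u, N u -> N [lie x, u]).
Proof.
move=> sN; split; first split=> [u _|a x y Nx Ny u Nu].
- by rewrite lie0l; apply: submodule0.
- by rewrite lie_linl; apply: sN.2; [apply: Nx|apply: Ny].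
- move=> x y Nx Ny u Nu; rewrite lie_leibnizl.
  apply: (submoduleD sN); first by apply: Nx; apply: Ny.
  by apply: (submoduleN sN); apply: Ny; apply: Nx.
Qed.

(** Since ad [x] is a derivation, stability of a generated subalgebra under ad [x] can be tested on
    its generators. *)
Lemma stabilizer_subalgebra S x : is_lie_subalgebra S ->
  is_lie_subalgebra (fun u => S u /\ S [lie x, u]).
Proof.
case=> sS SB; split; first split=> [|a u v [Su Sxu] [Sv Sxv]].
- by split; rewrite ?lie0r; apply: (submodule0 sS).
- by split; rewrite ?lie_linr; apply: sS.2.
- move=> u v [Su Sxu] [Sv Sxv]; split; first exact: SB.
  by rewrite lie_leibniz; apply: (submoduleD sS); apply: SB.
Qed.

End Subalgebras.

Lemma lie_kernel_subalgebra (C : comPzRingType) (L M : lieAlgType C) (f : {lie L -> M}) :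
  is_lie_subalgebra (fun u => f u = 0).
Proof.
split; first split=> [|a x y fx fy]; first exact: linear0.
  by rewrite linearP /= fx fy scaler0 addr0.
by move=> x y fx fy; rewrite lie_morph fx lie0l.
Qed.

(** * Subalgebras generated by part of a finite family *)

Section GeneratedSubalgebra.
Variables (C : comPzRingType) (L : lieAlgType C) (I : finType) (g : I -> L).
Implicit Types (Y : {set I}) (N : set L).

Definition gens Y : set L := fun u => exists2 y, y \in Y & u = g y.

Local Notation "<< Y >>" := (subalgebra_gen (gens Y)).

Lemma gen_subalgebra_mem Y y : y \in Y -> <<Y>> (g y).
Proof. by move=> Yy; apply: subalgebra_gen_sub; exists y. Qed.

Lemma span_sum_bracket Y N : is_submodule N ->
  (forall y z, y \in Y -> z \in Y -> N [lie g y, g z]) ->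
  forall y (a : I -> C), y \in Y -> (forall z, z \notin Y -> a z = 0) ->
  N [lie g y, \sum_z a z *: g z].
Proof.
move=> sN Ngg y a Yy a0; rewrite lie_sumr.
apply: (submodule_sum _ sN) => z _; rewrite lieZr.
have [Yz|/a0->] := boolP (z \in Y); first by apply: (submoduleZ _ sN); apply: Ngg.
by rewrite scale0r; apply: submodule0.
Qed.

Section Decomposition.
Variables (Y : {set I}) (N : set L).
Hypothesis subN : is_lie_subalgebra N.
Hypothesis Ngg : forall y z, y \in Y -> z \in Y -> N [lie g y, g z].
Hypothesis NgN : forall y w, y \in Y -> N w -> N [lie g y, w].

(** The submodule N + span(g y : y in Y), with coefficients extended by zero to the whole index
    type. *)
Let lin_mod u := exists2 a : I -> C, (forall y, y \notin Y -> a y = 0)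
    & N (u - \sum_y a y *: g y).

Let lin_mod_bracket u v : lin_mod u -> lin_mod v -> N [lie u, v].
Proof.
have [sN NB] := subN.
have Ngv y w : y \in Y -> lin_mod w -> N [lie g y, w].
  move=> Yy [a a0 Nw]; rewrite -[w](subrK (\sum_z a z *: g z)) lieDr.
  by apply: (submoduleD sN); [exact: NgN|exact: (@span_sum_bracket Y)].
move=> [a a0 Nu] nv; rewrite -[u](subrK (\sum_z a z *: g z)) lieDl.
apply: (submoduleD sN); last first.
  rewrite lieC lie_sumr; apply: (submoduleN sN); apply: (submodule_sum _ sN) => z _.
  rewrite lieZr; have [Yz|/a0->] := boolP (z \in Y).
    by rewrite lieC; apply: (submoduleZ _ sN); apply: (submoduleN sN); apply: Ngv.
  by rewrite scale0r; apply: (submodule0 sN).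
case: nv => b b0 Nv; rewrite -[v](subrK (\sum_z b z *: g z)) lieDr.
apply: (submoduleD sN); first exact: NB.
rewrite lie_sumr; apply: (submodule_sum _ sN) => z _.
rewrite lieZr; have [Yz|/b0->] := boolP (z \in Y).
  by rewrite lieC; apply: (submoduleZ _ sN); apply: (submoduleN sN); apply: NgN.
by rewrite scale0r; apply: (submodule0 sN).
Qed.

(** Brackets of elements of N + span(g y) fall into [N], so this sum is a subalgebra, and it
    contains the generators. *)
Lemma gen_subalgebra_lin_mod u : <<Y>> u -> lin_mod u.
Proof.
have [sN NB] := subN.
apply: subalgebra_sub; first split; first split=> [|a x y [b b0 Nb] [c c0 Nc]].
- exists (fun=> 0) => //; rewrite big1 ?subr0 => [|y _]; last exact: scale0r.
  exact: submodule0.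
- exists (fun z => a * b z + c z) => [z zY|]; first by rewrite b0 // c0 // mulr0 addr0.
  suff -> : a *: x + y - \sum_z (a * b z + c z) *: g z =
    a *: (x - \sum_z b z *: g z) + (y - \sum_z c z *: g z) by apply: sN.2.
  rewrite scalerBr addrACA -opprD scaler_sumr -big_split /=.
  by congr (_ - _); apply: eq_bigr => z _; rewrite scalerDl scalerA.
- move=> x y nx ny; exists (fun=> 0) => //.
  rewrite big1 ?subr0 => [|z _]; last exact: scale0r.
  exact: lin_mod_bracket.
- move=> _ [y Yy ->]; exists (fun z => (z == y)%:R) => [z|].
    by case: eqP => // ->; rewrite Yy.
  rewrite (bigD1 y) //= eqxx scale1r big1 => [|z /negPf->]; last by rewrite scale0r.
  by rewrite addr0 subrr; apply: submodule0.
Qed.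

Lemma gen_derived_sub_subalgebra u : derived_of <<Y>> u -> N u.
Proof.
apply: span_sub; first exact: subN.1.
by move=> _ [x [y [/gen_subalgebra_lin_mod nx /gen_subalgebra_lin_mod ny ->]]]; apply: lin_mod_bracket.
Qed.

End Decomposition.

(** This is the preceding decomposition with [N] the derived algebra of [<<Y>>] itself. *)
Lemma gen_subalgebra_decomp Y u : <<Y>> u ->
  exists2 a : I -> C, (forall y, y \notin Y -> a y = 0)
    & derived_of <<Y>> (u - \sum_y a y *: g y).
Proof.
have subS := subalgebra_genP (gens Y).
have dS := derived_of_submodule <<Y>>.
have DS w : derived_of <<Y>> w -> <<Y>> w by apply: derived_of_sub.
apply: gen_subalgebra_lin_mod.
- by split=> // x y /DS Sx /DS Sy; apply: derived_of_lie.
- by move=> y z Yy Yz; apply: derived_of_lie; apply: gen_subalgebra_mem.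
- by move=> y w Yy /DS Sw; apply: derived_of_lie => //; apply: gen_subalgebra_mem.
Qed.

(** A criterion for an [N] that need not be closed under brackets. By Jacobi, the [x] in [<<Y>>]
    with [x, <<Y>>] inside [N] form a subalgebra; the decomposition above puts the generators in
    it. *)
Lemma gen_derived_sub Y N : is_submodule N ->
  (forall y z, y \in Y -> z \in Y -> N [lie g y, g z]) ->
  (forall y w, y \in Y -> derived_of <<Y>> w -> N [lie g y, w]) ->
  forall u, derived_of <<Y>> u -> N u.
Proof.
move=> sN Ngg NgS.
have [sS SB] := subalgebra_genP (gens Y).
have Nyv y v : y \in Y -> <<Y>> v -> N [lie g y, v].
  move=> Yy /gen_subalgebra_decomp[a a0 Dv].
  rewrite -[v](subrK (\sum_z a z *: g z)) lieDr.
  by apply: (submoduleD sN); [exact: NgS|exact: (@span_sum_bracket Y)].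
suff NS : forall x, <<Y>> x -> forall v, <<Y>> v -> N [lie x, v].
  by apply: span_sub => // _ [x [y [Sx Sy ->]]]; apply: NS.
suff NS : forall x, <<Y>> x -> <<Y>> x /\ forall v, <<Y>> v -> N [lie x, v].
  by move=> x /NS[].
apply: subalgebra_sub; last first.
  by move=> _ [y Yy ->]; split=> [|v Sv]; [exact: gen_subalgebra_mem|exact: Nyv].
split; first split=> [|a x y [Sx Nx] [Sy Ny]].
- by split=> [|v _]; rewrite ?lie0l; apply: submodule0.
- split=> [|v Sv]; first exact: sS.2.
  by rewrite lie_linl; apply: sN.2; [exact: Nx|exact: Ny].
- move=> x y [Sx Nx] [Sy Ny]; split=> [|v Sv]; first exact: SB.
  rewrite lie_leibnizl; apply: (submoduleD sN); first by apply: Nx; apply: SB.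
  by apply: (submoduleN sN); apply: Ny; apply: SB.
Qed.

End GeneratedSubalgebra.

(** * Abelian Lie algebras and power series *)

Section AbelianLie.
Variables (C : comPzRingType) (V : lmodType C).

(** [V] with zero bracket, a target for linear forms that kill the derived algebra. *)
Definition abelian_lie : Type := V.

HB.instance Definition _ := GRing.Lmodule.on abelian_lie.

Definition abelian_br (x y : abelian_lie) : abelian_lie := 0.

Fact abelian_linl a x y z :
  abelian_br (a *: x + y) z = a *: abelian_br x z + abelian_br y z.
Proof. by rewrite /abelian_br scaler0 addr0. Qed.
Fact abelian_linr a x y z :
  abelian_br x (a *: y + z) = a *: abelian_br x y + abelian_br x z.
Proof. by rewrite /abelian_br scaler0 addr0. Qed.
Fact abelian_alt x : abelian_br x x = 0. Proof. by []. Qed.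
Fact abelian_jacobi x y z : abelian_br x (abelian_br y z) +
  abelian_br y (abelian_br z x) + abelian_br z (abelian_br x y) = 0.
Proof. by rewrite /abelian_br !addr0. Qed.

HB.instance Definition _ := isLie.Build C abelian_lie
  abelian_linl abelian_linr abelian_alt abelian_jacobi.

End AbelianLie.

Lemma derived_abelian (C : comPzRingType) (L : lieAlgType C) (V : lmodType C)
  (f : {lie L -> abelian_lie V}) u : derived L u -> f u = 0.
Proof.
move=> /(_ (fun v => f v = 0)); apply; split; last by move=> _ [x [y ->]]; rewrite lie_morph.
by split=> [|a x y fx fy]; rewrite ?linear0 // linearP /= fx fy scaler0 addr0.
Qed.

(* f : lie_series L stands for the power series sum_n f(n) t^n in L[[t]]. *)
Section PowerSeries.
Variables (C : comPzRingType) (L : lieAlgType C).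

Definition lie_series : Type := nat -> L.

HB.instance Definition _ := GRing.Lmodule.copy lie_series (nat -> L).

Definition series_br (f g : lie_series) : lie_series :=
  fun n => \sum_(i < n.+1) [lie f i, g (n - i)%N].

(** Index ranges independent of [n] allow the sums in iterated brackets to be exchanged. *)
Lemma series_brE f g n N : (n < N)%N ->
  series_br f g n = \sum_(i < N) \sum_(j < N | (i + j == n)%N) [lie f i, g j].
Proof.
move=> nN; rewrite /series_br (big_ord_widen N (fun i => [lie f i, g (n - i)%N])) //.
rewrite big_mkcond; apply: eq_bigr => i _; case: ifP => [|lt_in].
  rewrite ltnS => le_in.
  have h : (n - i < N)%N by rewrite (leq_ltn_trans (leq_subr _ _)).
  rewrite (big_pred1 (Ordinal h)) // => j.
  by rewrite /= -val_eqE /= -(eqn_add2l i (val j)) subnKC.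
rewrite big_pred0 // => j; apply: contraFF lt_in => /eqP <-.
by rewrite ltnS leq_addr.
Qed.

Lemma series_br2E f g h n : series_br f (series_br g h) n =
  \sum_(i < n.+1) \sum_(j < n.+1) \sum_(k < n.+1 | (i + j + k == n)%N)
    [lie f i, [lie g j, h k]].
Proof.
rewrite (series_brE _ _ (ltnSn n)); apply: eq_bigr => i _.
under eq_bigr => m _ do rewrite (series_brE _ _ (ltn_ord m)) lie_sumr.
rewrite exchange_big /=; apply: eq_bigr => j _.
under eq_bigr => m _ do rewrite lie_sumr.
rewrite (exchange_big_dep (fun k : 'I_n.+1 => (i + j + k == n)%N)) /=; last first.
  by move=> m k /eqP im /eqP jk; rewrite -addnA jk im.
apply: eq_bigr => k /eqP e; have lt_jk : (j + k < n.+1)%N.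
  by have := leq_addl i (j + k); rewrite addnA e ltnS.
rewrite (big_pred1 (Ordinal lt_jk)) // => m /=.
rewrite -val_eqE /= [RHS]eq_sym; case: (@eqP _ (j + k)%N) => [jk|_]; last by rewrite andbF.
by rewrite -jk addnA e eqxx.
Qed.

Fact series_linl a f g h :
  series_br (a *: f + g) h = a *: series_br f h + series_br g h.
Proof.
apply: funext => n; rewrite /series_br !fctE /= /series_br scaler_sumr -big_split /=.
by apply: eq_bigr => i _; rewrite -lie_linl.
Qed.
Fact series_linr a f g h :
  series_br f (a *: g + h) = a *: series_br f g + series_br f h.
Proof.
apply: funext => n; rewrite /series_br !fctE /= /series_br scaler_sumr -big_split /=.
by apply: eq_bigr => i _; rewrite -lie_linr.
Qed.
(** Among the pairs i + j = n the diagonal vanishes by alternation, and the swap of i and j cancels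
    the terms i < j against the terms i > j. *)
Fact series_alt f : series_br f f = 0.
Proof.
apply: funext => n; rewrite (series_brE _ _ (ltnSn n)) pair_big_dep /=.
rewrite (bigID (fun p : 'I_n.+1 * 'I_n.+1 => p.1 < p.2)%N) /=.
rewrite [X in _ + X](bigID (fun p : 'I_n.+1 * 'I_n.+1 => p.1 == p.2)) /=.
rewrite [X in _ + (X + _)]big1 ?add0r => [|p /andP[_ /eqP->]]; last exact: lie_alt.
rewrite [X in _ + X](reindex_inj (h := fun p : 'I_n.+1 * 'I_n.+1 => (p.2, p.1))); last first.
  by move=> [? ?] [? ?] [-> ->].
apply/eqP; rewrite addr_eq0 -sumrN; apply/eqP; apply: eq_big => [[i j]|[i j] _] /=.
  rewrite addnC -andbA -leqNgt -val_eqE /= ltn_neqAle andbC eq_sym.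
  by rewrite andbC; congr (_ && _); rewrite andbC eq_sym.
by rewrite lieC.
Qed.
Fact series_jacobi f g h : series_br f (series_br g h) +
  series_br g (series_br h f) + series_br h (series_br f g) = 0.
Proof.
apply: funext => n; rewrite !fctE /= !series_br2E.
(* The constraint i + j + k = n moves into the summands; the sums are then reordered so that i, j, k
   index [f], [g], [h] in all three terms, and Jacobi applies termwise. *)
under eq_bigr do under eq_bigr do rewrite big_mkcond.
under [X in _ + X + _]eq_bigr do under eq_bigr do rewrite big_mkcond.
under [X in _ + _ + X]eq_bigr do under eq_bigr do rewrite big_mkcond.
under [X in _ + X + _]eq_bigr do rewrite exchange_big.
rewrite [X in _ + X + _]exchange_big [X in _ + _ + X]exchange_big.
under [X in _ + _ + X]eq_bigr do rewrite exchange_big.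
rewrite -!big_split big1 // => i _ /=; rewrite -!big_split big1 // => j _ /=.
rewrite -!big_split big1 // => k _ /=.
rewrite [(j + k + i)%N]addnC addnA [(k + i)%N]addnC [(i + k + j)%N]addnAC.
by case: ifP => _; rewrite ?addr0 // lie_jacobi.
Qed.

HB.instance Definition _ := isLie.Build C lie_series
  series_linl series_linr series_alt series_jacobi.

(** The series x t^m. *)
Definition monomial m (x : L) : lie_series := fun n => if n == m then x else 0.

Fact monomial_linear m : linear (monomial m).
Proof.
move=> a x y; apply: funext => n; rewrite !fctE /= /monomial.
by case: eqP => // _; rewrite scaler0 addr0.
Qed.

Lemma monomial_br m x (f : lie_series) n :
  [lie (monomial m x : lie_series), f] n =
  if (m <= n)%N then [lie x, f (n - m)%N] else 0.
Proof.
rewrite -[LHS]/(series_br _ _ n) /series_br /monomial.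
have [le_mn|lt_nm] := leqP m n.
  have lt_mn : (m < n.+1)%N by [].
  rewrite (bigD1 (Ordinal lt_mn)) //= eqxx big1 ?addr0 // => i.
  by rewrite -val_eqE /= => /negPf ->; rewrite lie0l.
rewrite big1 // => i _; rewrite ltn_eqF ?lie0l //.
by rewrite (leq_trans (ltn_ord i)).
Qed.

Lemma monomial_lie m n x y :
  [lie (monomial m x : lie_series), (monomial n y : lie_series)] =
  monomial (m + n) [lie x, y].
Proof.
apply: funext => l; rewrite monomial_br /monomial.
have [le_ml|lt_lm] := leqP m l; first rewrite -[l in RHS](subnKC le_ml) eqn_add2l.
  by case: eqP => // _; rewrite lie0r.
by rewrite ltn_eqF // (leq_trans lt_lm) // leq_addr.
Qed.

End PowerSeries.

Section SeriesComponents.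
Variables (C : comPzRingType) (L : lieAlgType C) (p : {lie L -> lie_series L}).

Definition series_homogeneous : set L := fun u => exists m, p u = monomial m u.

Lemma series_morphP a u v n : p (a *: u + v) n = a *: p u n + p v n.
Proof. by rewrite linearP. Qed.

(** As [p] respects brackets, homogeneous elements are closed under them, so their span is a
    subalgebra, hence all of [L]. A homogeneous element is its own single component. *)
Lemma series_sum_components :
  (forall u, subalgebra_gen series_homogeneous u) ->
  forall u, exists2 N, (forall n, (N <= n)%N -> p u n = 0) & u = \sum_(n < N) p u n.
Proof.
move=> gen u.
have {gen} : span_gen series_homogeneous u.
  have := gen u; apply: subalgebra_sub => [|v hv]; last exact: sub_gen_smallest.
  apply: span_gen_subalgebra => x y [m px] [n py]; apply: sub_gen_smallest.
  by exists (m + n)%N; rewrite lie_morph px py monomial_lie.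
move: u; apply: span_sub; last first => [u [m pu]|].
  exists m.+1 => [n lt_mn|]; first by rewrite pu /monomial gtn_eqF.
  rewrite (bigD1 ord_max) //= pu /monomial eqxx big1 ?addr0 // => n.
  by rewrite -val_eqE /= => /negPf ->.
(* Padding with zero components brings two expansions to a common length. *)
have widen u N M : (N <= M)%N -> (forall n, (N <= n)%N -> p u n = 0) ->
    \sum_(n < M) p u n = \sum_(n < N) p u n.
  move=> le_NM pu0; rewrite [RHS](big_ord_widen M (p u)) // [RHS]big_mkcond /=.
  by apply: eq_bigr => n _; case: ltnP => // /pu0.
split=> [|a u v [N pu0 eu] [M pv0 ev]].
  by exists 0%N => [n _|]; rewrite ?big_ord0 // linear0.
have [le_N le_M] := (leq_maxl N M, leq_maxr N M).
exists (maxn N M) => [n|].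
  rewrite geq_max => /andP[/pu0 h /pv0 h'].
  by rewrite series_morphP h h' scaler0 addr0.
rewrite {1}eu {1}ev -(widen u _ _ le_N) // -(widen v _ _ le_M) //.
by rewrite scaler_sumr -big_split; apply: eq_bigr => n _; rewrite series_morphP.
Qed.

Lemma series_components_eq0 :
  (forall u, subalgebra_gen series_homogeneous u) ->
  forall u, (forall n, p u n = 0) -> u = 0.
Proof.
by move=> gen u pu0; have [N _ ->] := series_sum_components gen u; apply: big1.
Qed.

End SeriesComponents.

(** * Lie algebras of set-arrangements *)

Section ArrangementLieTheory.
Variables (C : comPzRingType) (X : finType) (A : set_arrangement X).
Variable R : arr_lie_data C A.

Local Notation L := (arr_lie R).
Local Notation g := (arr_gen R).
Local Notation "<< Y >>" := (subalgebra_gen (gens g Y)).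

Lemma arr_lie_generated u : <<[set: X]>> u.
Proof.
have [sS SB] := subalgebra_genP (gens g [set: X]).
have [x <-] := lie_pi_surj u; elim/freeLie_ind: x => [x||a x y Sx Sy|x y Sx Sy].
- exact: gen_subalgebra_mem.
- by rewrite linear0; apply: submodule0.
- by rewrite linearP; apply: sS.2.
- by rewrite lie_morph; apply: SB.
Qed.

Lemma arr_lie_subalgebra_ind (N : set L) : is_lie_subalgebra N ->
  (forall x, N (g x)) -> forall u, N u.
Proof.
move=> sN Ng u; have := arr_lie_generated u.
by apply: subalgebra_sub => // _ [x _ ->].
Qed.

Lemma arr_gen_comm x y : (forall D, D \in A -> ~~ ([set x; y] \subset D)) ->
  [lie g x, g y] = 0.
Proof. by move=> xy; rewrite -lie_morph; apply: lie_pi_rel; left; exists x, y. Qed.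

Lemma loc_map_rel D (DA : D \in A) (r : freeOn C D) : arr_rel R D r ->
  free_lift (fun x : elt D => g (val x)) r = 0.
Proof.
move=> Rr; rewrite -[RHS](@lie_pi_rel _ _ (arr_relations R) (freeOn_val C D r)); last first.
  by right; exists D => //; exists r.
elim/freeLie_ind: r {Rr} => [v||a x y gx gy|x y gx gy].
- by rewrite free_liftE free_mapE.
- by rewrite !linear0.
- by rewrite !linearP; congr (_ *: _ + _).
- by rewrite !lie_morph gx gy.
Qed.

Definition loc_map D (DA : D \in A) : {lie loc_lie R D -> L} :=
  quot_lift_hom (loc_map_rel DA).

Lemma loc_mapE D (DA : D \in A) (x : elt D) : loc_map DA (loc_gen R x) = g (val x).
Proof. exact: etrans (quot_liftE (loc_map_rel DA) _) (free_liftE _ _). Qed.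

(** The replacement condition speaks of the localization at [D]; [loc_map] carries it to [L]. *)
Lemma replacement_bracket : replacement_condition R ->
  forall D E y a b, D \in A -> E \in A -> E != D -> (3 <= #|D|)%N ->
    y \in D -> y \in E -> a \in D -> b \in D ->
  <<D :\ y>> [lie g a, g b].
Proof.
move=> repl D E y a b DA EA ED D3 yD yE aD bD.
have [sS SB] := subalgebra_genP (gens g (D :\ y)).
have := repl D DA D3 y yD (ex_intro2 _ _ E EA (conj ED yE)).
move=> /(_ _ (derived_lie (loc_gen R (exist _ a aD)) (loc_gen R (exist _ b bD)))).
move=> /(_ (fun u => <<D :\ y>> (loc_map DA u))).
rewrite lie_morph !loc_mapE; apply; split; last first.
  move=> _ [z zy ->]; rewrite loc_mapE; apply: gen_subalgebra_mem.
  by rewrite !inE zy (valP z).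
split; first split=> [|c u v Su Sv].
- by rewrite linear0; apply: submodule0.
- by rewrite linearP; apply: sS.2.
- by move=> u v Su Sv; rewrite lie_morph; apply: SB.
Qed.

(** The coefficient of [x] in the linear part descends to [L], because all relations lie in the
    derived algebra of the free Lie algebra. *)
Lemma arr_coord_rel x r : arr_relations R r ->
  (free_lift (fun y : X => (y == x)%:R : abelian_lie C^o) : {lie _ -> _}) r = 0.
Proof.
case=> [[y [z [_ ->]]]|[D DA [s Rs ->]]]; first by rewrite lie_morph.
have := arr_rel_derived DA Rs; move=> /(derived_morph (freeOn_val C D)).
exact: derived_abelian.
Qed.

Lemma arr_gen_free_mod_derived (a : X -> C) :
  derived L (\sum_x a x *: g x) -> forall x, a x = 0.
Proof.
move=> Da x.
have [f fE] : exists f : {lie L -> abelian_lie C^o}, forall y, f (g y) = (y == x)%:R.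
  exists (quot_lift_hom (@arr_coord_rel x)) => y.
  exact: etrans (quot_liftE (@arr_coord_rel x) _) (free_liftE _ _).
have := derived_abelian f Da; rewrite linear_sum (bigD1 x) //= big1 => [|y yx].
  by rewrite linearZ /= fE eqxx addr0 -[_ *: _]/(a x * 1) mulr1.
by rewrite linearZ /= fE (negPf yx) scaler0.
Qed.

(** Modulo the derived algebra of [<<Y>>], [u] is a combination of generators; this combination lies
    in L', so its coefficients vanish. *)
Lemma gen_derivedP Y u : <<Y>> u -> derived L u -> derived_of <<Y>> u.
Proof.
move=> /gen_subalgebra_decomp[a _ Dv] Du.
suff a0 : forall x, a x = 0.
  by move: Dv; rewrite big1 ?subr0 // => x _; rewrite a0 scale0r.
apply: arr_gen_free_mod_derived; rewrite -[X in derived L X](subKr u).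
have dL := derived_submodule L.
apply: (submoduleD dL) => //; apply: (submoduleN dL).
exact: derived_of_derived Dv.
Qed.

Section ClosedSub.
Variable B : closed_sub A.

Lemma csub_lie_ind (N : csub_lie R B -> Prop) : is_lie_subalgebra N ->
  (forall x, N (csub_gen R x)) -> forall u, N u.
Proof.
move=> [sN NB] Ng u.
have [x <-] := lie_pi_surj u; elim/freeLie_ind: x => [x||a x y Sx Sy|x y Sx Sy].
- exact: Ng.
- by rewrite linear0; apply: submodule0.
- by rewrite linearP; apply: sN.2.
- by rewrite lie_morph; apply: NB.
Qed.

Lemma pi_mapK u : pi_map R B (s_map R B u) = u.
Proof.
move: u; apply: csub_lie_ind => [|x]; last by rewrite s_mapE pi_mapE.
split; first split=> [|a x y ex ey].
- by rewrite !linear0.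
- by rewrite !linearP; congr (_ *: _ + _).
- by move=> x y ex ey; rewrite !lie_morph ex ey.
Qed.

Lemma s_map_gen u : <<supp B>> (s_map R B u).
Proof.
have [sS SB] := subalgebra_genP (gens g (supp B)).
move: u; apply: csub_lie_ind => [|x]; last first.
  by rewrite s_mapE; apply: gen_subalgebra_mem; apply: valP.
split; first split=> [|a x y ex ey].
- by rewrite linear0; apply: submodule0.
- by rewrite linearP; apply: sS.2.
- by move=> x y ex ey; rewrite lie_morph; apply: SB.
Qed.

Lemma im_s'_submodule : is_submodule (im_s' R B).
Proof.
have [d0 dD] := derived_submodule (csub_lie R B).
split=> [|a _ _ [u Du <-] [v Dv <-]]; first by exists 0 => //; rewrite linear0.
by exists (a *: u + v); [exact: dD|rewrite linearP].
Qed.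

Lemma im_s'_gen x y : x \in supp B -> y \in supp B -> im_s' R B [lie g x, g y].
Proof.
move=> xB yB; exists [lie csub_gen R (exist _ x xB), csub_gen R (exist _ y yB)].
  exact: derived_lie.
by rewrite lie_morph !s_mapE.
Qed.

Lemma im_s'_lie x u : x \in supp B -> im_s' R B u -> im_s' R B [lie g x, u].
Proof.
move=> xB [w Dw <-]; exists [lie csub_gen R (exist _ x xB), w]; first exact: derived_lie.
by rewrite lie_morph !s_mapE.
Qed.

Lemma im_s'_derived_of u : im_s' R B u -> derived_of <<supp B>> u.
Proof.
case=> w Dw <-; move: w Dw; apply: span_sub.
  have [d0 dD] := derived_of_submodule <<supp B>>.
  by split=> [|a x y Dx Dy]; rewrite ?linear0 // linearP; apply: dD.
by move=> _ [x [y ->]]; rewrite lie_morph; apply: derived_of_lie; apply: s_map_gen.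
Qed.

Lemma im_s'_derived u : im_s' R B u -> derived L u.
Proof. by move/im_s'_derived_of; apply: derived_of_derived. Qed.

End ClosedSub.

(** The generators commute modulo [J]; Jacobi extends this to the second argument and then to the
    first, so L/J is abelian. *)
Lemma derived_sub_ideal (J : set L) : is_lie_ideal J ->
  (forall x y, J [lie g x, g y]) -> forall u, derived L u -> J u.
Proof.
move=> [sJ JI] Jg.
have Jgu x u : J [lie g x, u].
  move: u; apply: arr_lie_subalgebra_ind => //; split; first exact: submodule_lier.
  move=> u v Ju Jv; rewrite lie_leibniz lieC; apply: (submoduleD sJ); last exact: JI.
  by apply: (submoduleN sJ); apply: JI.
have Juv u : forall v, J [lie u, v].
  move: u; apply: arr_lie_subalgebra_ind => //; split; first split=> [v|a u u' Ju Ju' v].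
  - by rewrite lie0l; apply: (submodule0 sJ).
  - by rewrite lie_linl; apply: sJ.2.
  move=> u u' Ju Ju' v; rewrite lie_leibnizl; apply: (submoduleD sJ); first exact: Ju.
  by apply: (submoduleN sJ); apply: Ju'.
by apply: span_sub => // _ [x [y ->]].
Qed.

End ArrangementLieTheory.

(** * Centralizing the derived algebra of a closed sub-arrangement *)

Section Centralizers.
Variables (C : comPzRingType) (X : finType) (A : set_arrangement X).
Variable R : arr_lie_data C A.

Local Notation L := (arr_lie R).
Local Notation g := (arr_gen R).
Local Notation "<< Y >>" := (subalgebra_gen (gens g Y)).

(* The grading of L is encoded by the morphism multiplying the component of
   degree n by t^n. *)
Lemma graded_series_morphism : graded_by_positive_degrees R ->
  exists (d : X -> nat) (p : {lie L -> lie_series L}),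
    (forall x, (0 < d x)%N) /\ forall x, p (g x) = monomial (d x) (g x).
Proof.
case=> d [d_gt0 hom]; exists d.
pose q := free_lift (fun x => monomial (d x) (g x) : lie_series L).
have q_hom m u : homogeneous d m u -> q u = monomial m (lie_pi _ u).
  elim=> {m u} [x|m n x y _ qx _ qy|m|m a x y _ qx _ qy].
  - by rewrite free_liftE.
  - by rewrite !lie_morph qx qy monomial_lie.
  - rewrite !linear0; apply: funext => n.
    by rewrite /monomial; case: ifP.
  - by rewrite !linearP monomial_linear; congr (_ *: _ + _).
have q_rel r : arr_relations R r -> q r = 0.
  (* Homogeneity of the ideal splits the relation into components [c m] in the ideal; [q] sends
     [c m] to t^m times its class, which is zero. *)
  move=> /(@sub_gen_smallest _ (@is_lie_ideal _ _)) /hom[N [c [c_hom ->]]].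
  rewrite linear_sum big1 // => m _; have [/q_hom qc /lie_pi_eq0 c0] := c_hom m.
  apply: etrans qc _; rewrite c0.
  by apply: funext => n; rewrite /monomial; case: ifP.
exists (quot_lift_hom q_rel); split=> // x.
exact: etrans (quot_liftE q_rel _) (free_liftE _ _).
Qed.

Variable B : closed_sub A.
Hypothesis repl : replacement_condition R.
Hypothesis two_disjoint : forall D E : {set X}, D \in A -> E \in A ->
  #|D| = 2%N -> #|E| = 2%N -> D != E -> [disjoint D & E].

Let S := supp B.

Let suppP y : y \in S -> exists2 E, E \in (B : {set {set X}}) & y \in E.
Proof. by move=> /bigcupP. Qed.

Let BA (E : {set X}) : E \in (B : {set {set X}}) -> E \in A.
Proof. exact: (fintype.subsetP (csub_sub B)). Qed.

Let notin_csub (D : {set X}) x : x \in D -> x \notin S -> D \notin (B : {set {set X}}).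
Proof. by move=> xD; apply: contra => DB; apply/bigcupP; exists D. Qed.

(** Phrased as the centralizer of a subset of [L], to make [centralizer_subalgebra] applicable. *)
Let centralizes (w : L) := forall v, gens g (~: S) v -> [lie v, w] = 0.

Let centralizesE w : centralizes w <-> forall x, x \notin S -> [lie g x, w] = 0.
Proof.
split=> [Zw x xS|Zw v [x xS ->]]; last by apply: Zw; move: xS; rewrite inE.
by apply: Zw; exists x; rewrite ?inE.
Qed.

(* [[x, y], w] = 0: if x and y lie in a set D then |D| >= 3, so that [x, y] is
   a Lie polynomial in the generators D :\ y, which are all outside S. *)
Lemma centralizer_step x y w : x \notin S -> y \in S -> [set x; y] \notin A ->
  (forall z, z \notin S -> [lie g z, w] = 0) -> [lie g x, [lie g y, w]] = 0.
Proof.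
move=> xS yS xyA Zw; rewrite lie_leibniz (Zw x xS) lie0r addr0.
have [[D DA xyD]|noD] := pselect (exists2 D, D \in A & [set x; y] \subset D); last first.
  rewrite arr_gen_comm ?lie0l // => D DA; apply/negP => xyD.
  by apply: noD; exists D.
have [xD yD] : x \in D /\ y \in D.
  by split; apply: (fintype.subsetP xyD); rewrite !inE eqxx ?orbT.
have DB := notin_csub xD xS; have [E EB yE] := suppP yS.
have D3 : (3 <= #|D|)%N.
  rewrite ltn_neqAle (arr_ge2 (s := A)) // andbT; apply: contraNneq xyA => D2.
  suff -> : [set x; y] = D by [].
  apply/eqP; rewrite eqEcard xyD -D2 cards2.
  by rewrite (contraNneq _ xS) // => ->.
have ED : E != D by apply: contraNneq DB => <-.
have := replacement_bracket repl DA (BA EB) ED D3 yD yE xD yD.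
have ZW := centralizer_subalgebra (fun v : L => v = w).
suff H u : <<D :\ y>> u -> [lie w, u] = 0.
  by move=> /H; rewrite lieC => /eqP; rewrite oppr_eq0 => /eqP.
move=> Du; apply: (subalgebra_sub ZW _ Du) => // v [z].
rewrite !inE => /andP[zy zD] -> _ ->; rewrite lieC Zw ?oppr0 //.
(* Closedness lets [D] meet [S] in at most one point, which is [y]. *)
apply: contraNN zy => zS; apply/eqP.
by apply: (card_le1_eqP (csub_closed DA DB)); rewrite !inE ?zD ?yD.
Qed.

(* Every E in B containing y has at least three elements, so the replacement
   condition makes the subalgebra of S :\ y stable under ad y. *)
Lemma derived_of_supp_avoid x y : x \notin S -> y \in S -> [set x; y] \in A ->
  forall u, derived_of <<S>> u -> derived_of <<S :\ y>> u.
Proof.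
move=> xS yS xyA u Du; apply: gen_derivedP; last exact: derived_of_derived Du.
have sT := subalgebra_genP (gens g (S :\ y)).
have Tz z : z \in S -> <<S :\ y>> [lie g y, g z].
  move=> zS; have [<-|neq_yz] := eqVneq y z.
    by rewrite lie_alt; apply: (submodule0 sT.1).
  have [[E EA yzE]|noE] := pselect (exists2 E, E \in A & [set y; z] \subset E); last first.
    rewrite arr_gen_comm; first exact: (submodule0 sT.1).
    by move=> E EA; apply/negP => yzE; apply: noE; exists E.
  have [yE zE] : y \in E /\ z \in E.
    by split; apply: (fintype.subsetP yzE); rewrite !inE eqxx ?orbT.
  (* [E] contains two distinct points of [S], so closedness forces it into [B]. *)
  have EB : E \in (B : {set {set X}}).
    apply: contraNT neq_yz => EB; apply/eqP.
    by apply: (card_le1_eqP (csub_closed EA EB)); rewrite !inE ?yE ?zE.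
  have Exy : [set x; y] != E.
    by apply: contraTneq EB => <-; apply: (notin_csub _ xS); rewrite set21.
  (* A two-element [E] would be disjoint from the pair {x, y}, yet both contain [y]. *)
  have E3 : (3 <= #|E|)%N.
    rewrite ltn_neqAle (arr_ge2 (s := A)) // andbT; apply/eqP => E2.
    have xy2 : #|[set x; y]| = 2%N.
      by rewrite cards2 (contraNneq _ xS) // => ->.
    have /disjoint_setI0/setP/(_ y) := two_disjoint xyA EA xy2 (esym E2) Exy.
    by rewrite !inE eqxx yE orbT.
  have yxy : y \in [set x; y] by rewrite set22.
  have := replacement_bracket repl EA xyA Exy E3 yE yxy yE zE.
  apply: subalgebra_mono => _ [t tE ->]; exists t => //; move: tE.
  by rewrite !inE => /andP[-> tE]; apply/bigcupP; exists E.
have Ty w : <<S :\ y>> w -> <<S :\ y>> [lie g y, w].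
  move=> Tw.
  suff [] : <<S :\ y>> w /\ <<S :\ y>> [lie g y, w] by [].
  apply: (subalgebra_sub (stabilizer_subalgebra (g y) sT) _ Tw) => _ [z zS ->].
  by split; [exact: gen_subalgebra_mem|apply: Tz; move: zS; rewrite !inE => /andP[]].
have Tg z : z \in S -> z = y \/ <<S :\ y>> (g z).
  move=> zS; have [->|zy] := eqVneq z y; [by left|right].
  by apply: gen_subalgebra_mem; rewrite !inE zy.
apply: (gen_derived_sub_subalgebra sT _ _ Du) => z w.
  move=> /[dup] zS /Tg[-> /Tz //|Tgz] /[dup] wS /Tg[->|Tgw]; last exact: sT.2.
  by rewrite lieC; apply: (submoduleN sT.1); apply: Tz.
by move=> /Tg[-> /Ty //|Tgz] Tw; apply: sT.2.
Qed.

(** Two-element sets being disjoint, at most one [y] in [S] forms a pair of [A] with [x]; [Y] omits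
    it. *)
Lemma derived_of_supp_avoid_pairs x : x \notin S ->
  exists Y : {set X}, [/\ Y \subset S,
    forall u, derived_of <<S>> u -> derived_of <<Y>> u
    & forall y, y \in Y -> [set x; y] \notin A].
Proof.
move=> xS; have [[y yS xyA]|noy] := pselect (exists2 y, y \in S & [set x; y] \in A).
  exists (S :\ y); split; first exact: subD1set.
    exact: derived_of_supp_avoid xS yS xyA.
  move=> z; rewrite !inE => /andP[zy zS]; apply/negP => xzA.
  have c2 t : t \in S -> #|[set x; t]| = 2%N.
    by move=> tS; rewrite cards2 (contraNneq _ xS) // => ->.
  have neq : [set x; z] != [set x; y].
    apply: contraNneq zy => /setP/(_ z); rewrite !inE eqxx orbT => /esym/orP[]// /eqP zx.
    by move: zS; rewrite zx (negPf xS).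
  have /disjoint_setI0/setP/(_ x) := two_disjoint xzA xyA (c2 z zS) (c2 y yS) neq.
  by rewrite !inE eqxx.
by exists S; split=> // y yS; apply/negP => xyA; apply: noy; exists y.
Qed.

Hypothesis comm3 : forall x y z, y \in S -> z \in S -> x \notin S ->
  [lie g x, [lie g y, g z]] = 0.

(** If a pair {x, y} of [A] leaves [S], it is the only one meeting [S], so Y = S \ y works for all
    outside generators at once; their centralizer is then a subalgebra stable under the generators
    in [Y]. *)
Lemma centralizer_few_pairs :
  (forall D E : {set X}, D \in A -> E \in A -> #|D| = 2%N -> #|E| = 2%N ->
     ~~ [disjoint S & D] -> ~~ [disjoint S & E] -> D = E) ->
  forall u, derived_of <<S>> u -> forall x, x \notin S -> [lie g x, u] = 0.
Proof.
move=> few u Du.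
suff [Y [YS DY noY]] : exists Y : {set X}, [/\ Y \subset S, derived_of <<Y>> u
    & forall x y, x \notin S -> y \in Y -> [set x; y] \notin A].
  apply/centralizesE; move: DY.
  apply: (gen_derived_sub_subalgebra (centralizer_subalgebra _)).
    move=> y z /(fintype.subsetP YS) yS /(fintype.subsetP YS) zS.
    by apply/centralizesE => x xS; apply: comm3.
  move=> y w yY /centralizesE Zw; apply/centralizesE => x xS.
  by apply: centralizer_step => //; [apply: (fintype.subsetP YS)|apply: noY].
have [[x [y [xS yS xyA]]]|no] := pselect (exists x y, [/\ x \notin S, y \in S & [set x; y] \in A]).
  exists (S :\ y); split; [exact: subD1set|exact: derived_of_supp_avoid xS yS xyA _ Du|].
  move=> x' y' x'S; rewrite !inE => /andP[y'y y'S]; apply/negP => xyA'.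
  have c2 s t : s \notin S -> t \in S -> #|[set s; t]| = 2%N.
    by move=> sS tS; rewrite cards2 (contraNneq _ sS) // => ->.
  have meet s t : t \in S -> ~~ [disjoint S & [set s; t]].
    by move=> tS; apply/pred0Pn; exists t; rewrite /= tS set22.
  have /setP/(_ y') := few _ _ xyA' xyA (c2 _ _ x'S y'S) (c2 _ _ xS yS) (meet _ _ y'S) (meet _ _ yS).
  (* The two pairs coincide, so y' would be [x], which is outside [S]. *)
  rewrite !inE eqxx orbT (negPf y'y) orbF => /esym/eqP y'x.
  by move: xS; rewrite -y'x y'S.
exists S; split=> // x y xS yS; apply/negP => xyA.
by apply: no; exists x, y.
Qed.

(* Induction on the degree n of the component p u n: replacement rewrites words
   without preserving their length, but it preserves their degree. *)
Lemma centralizer_graded : graded_by_positive_degrees R ->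
  forall u, derived_of <<S>> u -> forall x, x \notin S -> [lie g x, u] = 0.
Proof.
move=> /graded_series_morphism[d [p [d_gt0 pg]]].
have p_br y w n : p [lie g y, w] n = if (d y <= n)%N then [lie g y, p w (n - d y)%N] else 0.
  by rewrite lie_morph pg monomial_br.
(* The induction keeps all [x] together: [Y] is chosen for one [x], but [centralizer_step] needs the
   lower component to commute with every outside generator. *)
have Zp n : forall u, derived_of <<S>> u -> forall x, x \notin S -> [lie g x, p u n] = 0.
  elim/ltn_ind: n => n IHn u Du x xS.
  have [Y [/fintype.subsetP YS /(_ u Du) DY noY]] := derived_of_supp_avoid_pairs xS.
  move: u DY {Du}; apply: gen_derived_sub.
  - split=> [|a u v pu pv]; first by rewrite linear0 lie0r.
    by rewrite series_morphP lie_linr pu pv scaler0 addr0.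
  - move=> y z yY zY; rewrite p_br pg /monomial.
    case: ifP => _; last exact: lie0r.
    by case: ifP => _; [exact: comm3 (YS _ yY) (YS _ zY) xS|rewrite !lie0r].
  - move=> y w yY Dw; rewrite p_br; case: ifP => [le_dn|_]; last exact: lie0r.
    apply: centralizer_step => //; [exact: YS|exact: noY|].
    (* Positivity of the degree of [y] makes the degree drop; since Y is inside S, [w] remains in
       the derived algebra of [<<S>>]. *)
    apply: IHn; first by rewrite ltn_subrL d_gt0 (leq_trans (d_gt0 y)).
    move: Dw; apply: span_sub; first exact: derived_of_submodule.
    move=> _ [s [t [Ys Yt ->]]].
    have YSS : forall v, <<Y>> v -> <<S>> v.
      by apply: subalgebra_mono => _ [z /YS zS ->]; exists z.
    by apply: derived_of_lie; apply: YSS.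
(* The generators of [L] are homogeneous for [p], so an element vanishes once all its components
   do. *)
move=> u Du x xS; apply: (@series_components_eq0 _ _ p) => [v|n].
  apply: arr_lie_subalgebra_ind; first exact: subalgebra_genP.
  by move=> y; apply: subalgebra_gen_sub; exists (d y).
by rewrite p_br; case: ifP => // _; apply: Zp.
Qed.

End Centralizers.

(** * Partitions into closed sub-arrangements *)

Section Partition.
Variables (C : comPzRingType) (X : finType) (A : set_arrangement X).
Variables (R : arr_lie_data C A) (k : nat) (B : 'I_k -> closed_sub A).
Hypothesis B_disjoint : forall i j : 'I_k, i != j ->
  [disjoint (B i : {set {set X}}) & (B j : {set {set X}})].
Hypothesis B_cover : (\bigcup_(i < k) (B i : {set {set X}}))%SET = A :> {set {set X}}.

Local Notation L := (arr_lie R).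
Local Notation g := (arr_gen R).

(** If distinct [y], [z] lay in both supports and in a common [D], closedness would put [D] in both
    [B i] and [B j]. *)
Lemma pi_map_bracket0 i j y z : i != j -> y \in supp (B i) -> z \in supp (B i) ->
  pi_map R (B j) [lie g y, g z] = 0.
Proof.
move=> ij yi zi; rewrite lie_morph.
have [yj|yj] := boolP (y \in supp (B j)); last by rewrite pi_mapE0 // lie0l.
have [zj|zj] := boolP (z \in supp (B j)); last by rewrite (pi_mapE0 R zj) lie0r.
have [<-|neq_yz] := eqVneq y z; first exact: lie_alt.
rewrite -lie_morph arr_gen_comm ?linear0 // => D DA; apply/negP => yzD.
have [yD zD] : y \in D /\ z \in D.
  by split; apply: (fintype.subsetP yzD); rewrite !inE eqxx ?orbT.
have Dmem l : y \in supp (B l) -> z \in supp (B l) -> D \in (B l : {set {set X}}).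
  move=> yl zl; apply: contraNT neq_yz => Dl; apply/eqP.
  by apply: (card_le1_eqP (csub_closed DA Dl)); rewrite !inE ?yD ?zD.
have /pred0P/(_ D) := B_disjoint ij.
by rewrite /= !Dmem.
Qed.

Lemma pi_map_derived0 i j u : i != j ->
  derived (csub_lie R (B i)) u -> pi_map R (B j) (s_map R (B i) u) = 0.
Proof.
move=> ij Du; have : im_s' R (B i) (s_map R (B i) u) by exists u.
move=> /im_s'_derived_of.
apply: (gen_derived_sub_subalgebra (lie_kernel_subalgebra (pi_map R (B j)))).
- by move=> y z; apply: pi_map_bracket0.
- by move=> y w _ ew; rewrite lie_morph ew lie0r.
Qed.

Lemma val_s'_map (u : dsum_derived R B) :
  val (s'_map R B u) = \sum_(i < k) s_map R (B i) (val (u i)).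
Proof. by rewrite /s'_map raddf_sum. Qed.

Lemma s'_mapK u : pi'_map R B (s'_map R B u) = u.
Proof.
apply: functional_extensionality_dep => j; apply: val_inj.
rewrite -[LHS]/(pi_map R (B j) (val (s'_map R B u))) val_s'_map linear_sum.
rewrite (bigD1 j) // big1 => [|i ij].
  exact: etrans (addr0 _) (pi_mapK _).
by apply: pi_map_derived0 => //; apply: derived_valP.
Qed.

Lemma sum_im_s'_derived u : sum_im_s' R B u -> derived L u.
Proof.
case=> f [fB ->]; apply: submodule_sum => [|i _]; first exact: derived_submodule.
exact: im_s'_derived (fB i).
Qed.

Lemma sum_im_s'_ideal : (forall i, is_lie_ideal (im_s' R (B i))) ->
  is_lie_ideal (sum_im_s' R B).
Proof.
move=> idB; split; first split=> [|a _ _ [f [fB ->]] [h [hB ->]]].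
- exists (fun=> 0); split=> [i|]; first exact: submodule0 (idB i).1.
  by rewrite big1.
- exists (fun i => a *: f i + h i); split=> [i|]; first exact: (idB i).1.2.
  by rewrite scaler_sumr -big_split.
- move=> x _ [f [fB ->]]; exists (fun i => [lie x, f i]).
  by split=> [i|]; [exact: (idB i).2|exact: lie_sumr].
Qed.

(** Either no set of [A] contains both generators and they commute, or such a set belongs to some
    [B i], whose summand contains the bracket. *)
Lemma sum_im_s'_gen x y : sum_im_s' R B [lie g x, g y].
Proof.
have [[D DA xyD]|noD] := pselect (exists2 D, D \in A & [set x; y] \subset D); last first.
  rewrite arr_gen_comm; last by move=> D DA; apply/negP => xyD; apply: noD; exists D.
  exists (fun=> 0); split=> [i|]; first exact: submodule0 (im_s'_submodule R _).
  by rewrite big1.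
have [xD yD] : x \in D /\ y \in D.
  by split; apply: (fintype.subsetP xyD); rewrite !inE eqxx ?orbT.
move: DA; rewrite -B_cover => /bigcupP[i _ DB].
exists (fun j => if j == i then [lie g x, g y] else 0); split=> [j|].
  case: eqP => [->|_]; last exact: submodule0 (im_s'_submodule R _).
  by apply: im_s'_gen; apply/bigcupP; exists D.
by rewrite (bigD1 i) //= eqxx big1 ?addr0 // => j /negPf ->.
Qed.

End Partition.

Theorem theorem3p8 (C : comPzRingType) (X : finType) (A : set_arrangement X)
    (R : arr_lie_data C A) (k : nat) (B : 'I_k -> closed_sub A)
    (B_disjoint : forall i j : 'I_k, i != j ->
       [disjoint (B i : {set {set X}}) & (B j : {set {set X}})])
    (B_cover : (\bigcup_(i < k) (B i : {set {set X}}))%SET = A :> {set {set X}})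
    (A_replacement : replacement_condition R)
    (A_two_disjoint : forall D E : {set X}, D \in A -> E \in A ->
       #|D| = 2%N -> #|E| = 2%N -> D != E -> [disjoint D & E])
    (graded_or_few_two :
       graded_by_positive_degrees R \/
       forall (i : 'I_k) (D E : {set X}), D \in A -> E \in A ->
         #|D| = 2%N -> #|E| = 2%N ->
         ~~ [disjoint supp (B i) & D] -> ~~ [disjoint supp (B i) & E] -> D = E) :
  [<->
    forall (i : 'I_k) (x : X), x \notin supp (B i) ->
      forall u : arr_lie R, im_s' R (B i) u -> [lie arr_gen R x, u] = 0;
    forall i : 'I_k, is_lie_ideal (im_s' R (B i));
    derived (arr_lie R) = sum_im_s' R B;
    forall v : derived_alg (arr_lie R), exists u : dsum_derived R B, s'_map R B u = v;
    injective (pi'_map R B);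
    forall (i : 'I_k) (x y z : X),
      y \in supp (B i) -> z \in supp (B i) -> x \notin supp (B i) ->
      [lie arr_gen R x, [lie arr_gen R y, arr_gen R z]] = 0 ].
Proof.
tfae.
(* 1 => 2: the normalizer of the image is a subalgebra; generators in the support preserve the
   image, and the others kill it. *)
- move=> central i; have sI := im_s'_submodule R (B i).
  split=> // x u; move: x u.
  apply: arr_lie_subalgebra_ind; first exact: normalizer_subalgebra.
  move=> x u iu; have [xB|xB] := boolP (x \in supp (B i)); first exact: im_s'_lie.
  by rewrite (central i) //; apply: submodule0.
(* 2 => 3: the sum is an ideal containing all brackets of generators. *)
- move=> idB; apply/seteqP; split=> u; last exact: sum_im_s'_derived.
  apply: derived_sub_ideal; first exact: sum_im_s'_ideal.
  exact: sum_im_s'_gen.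
- move=> dE v; have : sum_im_s' R B (val v) by rewrite -dE; apply: derived_valP.
  case=> f [fB vE].
  have [w wf] : exists w : dsum_derived R B, forall i, s_map R (B i) (val (w i)) = f i.
    (* Choice selects preimages for all [i] simultaneously. *)
    suff /(_ _)/cid h i : exists u : derived_alg (csub_lie R (B i)), s_map R (B i) (val u) = f i.
      by exists (fun i => projT1 (h i)) => i; apply: projT2 (h i).
    by have [u Du uE] := fB i; exists (DerivedAlg (mem_set Du)).
  exists w; apply: val_inj; rewrite val_s'_map vE.
  by apply: eq_bigr => i _; apply: wf.
(* 4 => 5: a left inverse of a surjection is injective. *)
- move=> surj v w; have [[u <-] [u' <-]] := (surj v, surj w).
  by rewrite !s'_mapK // => ->.
- move=> inj i x y z yi zi xi.
  pose v := DerivedAlg (mem_set (derived_lie (arr_gen R x) [lie arr_gen R y, arr_gen R z])).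
  suff : v = 0 by move/(congr1 val).
  apply: inj; apply: functional_extensionality_dep => j; apply: val_inj.
  rewrite -[LHS]/(pi_map R (B j) (val v)) -[RHS]/(pi_map R (B j) 0) linear0 /v.
  have [<-|ij] := eqVneq i j.
    by rewrite lie_morph pi_mapE0 // lie0l.
  by rewrite lie_morph (pi_map_bracket0 _ _ ij) // lie0r.
(* 6 => 1: the image lies in the derived algebra of the subalgebra generated by the support, which
   the outside generators centralize. *)
- move=> comm3 i x xi u /im_s'_derived_of Du.
  case: graded_or_few_two => [graded|few].
    by apply: (centralizer_graded A_replacement A_two_disjoint _ graded Du) => //; apply: comm3.
  by apply: (centralizer_few_pairs A_replacement A_two_disjoint _ (few i) Du) => //; apply: comm3.
Qed.
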